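(* Let $M$ and $M'$ be $Z$-free $E$-$E$-bimodules with $Z$-free generators $M_0$ and $M_0'$, respectively. Let $\varphi:\mathcal{F}_E(M)\to\mathcal{F}_E(M')$ be an algebra isomorphism such that $\varphi|_E=\mathrm{id}_E$. Then $$\varphi(R(P))=R(\varphi(P))$$ for every potential $P$ of $\mathcal{F}_E(M)$.
   Context: $F$ is a field, $E_1,\dots,E_n$ are finite-dimensional semisimple $F$-algebras, $E=\prod_{i=1}^nE_i$, $e_i\in E$ is the image of the identity of $E_i$, and $Z=\sum_i Fe_i\subseteq E$. All bimodules $M$ considered are finite-dimensional over $F$ with $F$ acting centrally. $\mathcal{F}_E(M)=\prod_{i\ge 0}M^{\otimes i}$ (tensor powers over $E$, $M^{\otimes0}=E$), with product $(fg)(i)=\sum_{s+t=i}f(s)g(t)$ ($f(i)$ is the degree $i$ component) and the topology of the metric $d(f,g)=2^{-\nu(f-g)}$, $\nu(h)=\min\{i:h(i)\ne0\}$. $T_E(M)\subseteq\mathcal F_E(M)$ is the tensor algebra. A potential is an element $P\in\mathcal{F}_E(M)$ with $P=\sum_i e_iPe_i$. $M$ is $Z$-free if there is a $Z$-$Z$-subbimodule $M_0$ (a $Z$-free generator) such that the multiplication map $E\otimes_ZM_0\otimes_ZE\to M$ is an isomorphism of $E$-$E$-bimodules. Cyclic derivative (for $M$ with $Z$-free generator $M_0$): let $A'=T_E(M)$ and let $\Delta:A'\to A'\otimes_ZA'$ be the unique $F$-derivation with $\Delta(s)=1\otimes s-s\otimes1$ for $s\in E$ and $\Delta(m)=1\otimes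 m$ for $m\in M_0$. Let $u:A'\otimes_ZA'\to A'$, $u(a\otimes b)=\sum_ie_ibae_i$. Put $\mathfrak h(f)(g)=u(\Delta(f)g)$ for $f,g\in A'$, and for $f,g\in\mathcal F_E(M)$, $\mathfrak h(f)(g)(l)=\sum_{i+j=l}\mathfrak h(f(i))(g(j))$. Put $\delta(f)=\mathfrak h(f)(1)$. For $\psi\in M^*=\mathrm{Hom}_E(M_E,E_E)$ (right $E$-linear maps), extend $\psi$ to $\mathcal F_E(M)$ by $\psi(s)=0$ for $s\in E$, $\psi(m_1\cdots m_l)=\psi(m_1)m_2\cdots m_l$, and $\psi(f)=\sum_l\psi(f(l))$; put $\delta_\psi(f)=\psi(\delta(f))$. The ideal $R(P)$: choose an $F$-basis $A_{i,j}$ of each nonzero $e_iM_0e_j$ and let $A=\bigcup A_{i,j}$; for $a\in A_{i,j}$ write $\tau(a)=i$, $\sigma(a)=j$. For each $i$ choose an $F$-basis $L(i)$ of $e_iE$. For $a\in A$, $s\in L(\tau(a))$, let $(sa)^*:M_E\to E$ be the right $E$-linear map with $(sa)^*(sa)=e_{\sigma(a)}$ and $(sa)^*(s'a')=0$ for all other products $s'a'$ with $a'\in A$, $s'\in L(\tau(a'))$. Put $X_{a^*}(P)=\sum_{s\in L(\tau(a))}\delta_{(sa)^*}(P)s$. Then $R(P)$ is the closure of the two-sided ideal of $\mathcal F_E(M)$ generated by all $X_{a^*}(P)$, $a\in A$. For potentials in $\mathcal F_E(M')$, $R$ is defined in the same way using $M_0'$ and bases $A'(i,j)$ of the nonzero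 $e_iM_0'e_j$. *)

(* Defs.v *)
From HB Require Import structures.
From mathcomp Require Import all_boot all_order all_algebra falgebra.
From mathcomp Require Import generic_quotient boolp classical_sets.

Set Implicit Arguments.
Unset Strict Implicit.
Unset Printing Implicit Defensive.

Import Order.TTheory GRing.Theory Num.Theory.
Local Open Scope ring_scope.
Local Open Scope quotient_scope.

Section ProdAlg.
Import VectorInternalTheory.
Variables (F : fieldType) (n : nat) (Ei : 'I_n.+1 -> falgType F).

(* A [falgType] is nonzero, hence the nonempty index type ['I_n.+1].          *)
Definition prodalg : Type := {dffun forall i, Ei i}.
HB.instance Definition _ := Choice.on prodalg.

Definition mkprod (f : forall i, Ei i) : prodalg := [ffun i => f i].
Definition prod_proj (x : prodalg) (i : 'I_n.+1) : Ei i := x i.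

Lemma prodP (x y : prodalg) :
  (forall i, prod_proj x i = prod_proj y i) -> x = y.
Proof. by move=> h; apply/ffunP. Qed.

Lemma mkprodE f i : prod_proj (mkprod f) i = f i.
Proof. by rewrite /prod_proj ffunE. Qed.

Let padd x y := mkprod (fun i => prod_proj x i + prod_proj y i).
Let popp x := mkprod (fun i => - prod_proj x i).
Let pzero := mkprod (fun i => 0).
Let pone := mkprod (fun i => 1).
Let pmul x y := mkprod (fun i => prod_proj x i * prod_proj y i).
Let pscale (c : F) x := mkprod (fun i => c *: prod_proj x i).

Fact padd_A : associative padd.
Proof. by move=> x y z; apply/prodP => i; rewrite !mkprodE addrA. Qed.
Fact padd_C : commutative padd.
Proof. by move=> x y; apply/prodP => i; rewrite !mkprodE addrC. Qed.
Fact padd_0 : left_id pzero padd.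
Proof. by move=> x; apply/prodP => i; rewrite !mkprodE add0r. Qed.
Fact padd_N : left_inverse pzero popp padd.
Proof. by move=> x; apply/prodP => i; rewrite !mkprodE addNr. Qed.
HB.instance Definition _ :=
  GRing.isZmodule.Build prodalg padd_A padd_C padd_0 padd_N.

Lemma proj_add x y i : prod_proj (x + y) i = prod_proj x i + prod_proj y i.
Proof. exact: mkprodE. Qed.
Lemma proj_zero i : prod_proj 0 i = 0.
Proof. exact: mkprodE. Qed.

Fact pmul_A : associative pmul.
Proof. by move=> x y z; apply/prodP => i; rewrite !mkprodE mulrA. Qed.
Fact pmul_1 : left_id pone pmul.
Proof. by move=> x; apply/prodP => i; rewrite !mkprodE mul1r. Qed.
Fact pmul_r1 : right_id pone pmul.
Proof. by move=> x; apply/prodP => i; rewrite !mkprodE mulr1. Qed.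
Fact pmul_Dl : left_distributive pmul +%R.
Proof.
by move=> x y z; apply/prodP => i; rewrite ?(proj_add, mkprodE) mulrDl.
Qed.
Fact pmul_Dr : right_distributive pmul +%R.
Proof.
by move=> x y z; apply/prodP => i; rewrite ?(proj_add, mkprodE) mulrDr.
Qed.
Fact pone_neq0 : pone != 0.
Proof.
apply/eqP => /(congr1 (prod_proj^~ ord0)) /eqP.
by rewrite mkprodE proj_zero oner_eq0.
Qed.
HB.instance Definition _ := GRing.Zmodule_isNzRing.Build prodalg
  pmul_A pmul_1 pmul_r1 pmul_Dl pmul_Dr pone_neq0.

Lemma proj_mul x y i : prod_proj (x * y) i = prod_proj x i * prod_proj y i.
Proof. exact: mkprodE. Qed.
Lemma proj_one i : prod_proj 1 i = 1.
Proof. exact: mkprodE. Qed.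

Fact pscaleA a b x : pscale a (pscale b x) = pscale (a * b) x.
Proof. by apply/prodP => i; rewrite !mkprodE scalerA. Qed.
Fact pscale1 : left_id 1 pscale.
Proof. by move=> x; apply/prodP => i; rewrite !mkprodE scale1r. Qed.
Fact pscaleDr : right_distributive pscale +%R.
Proof.
by move=> a x y; apply/prodP => i; rewrite ?(proj_add, mkprodE) scalerDr.
Qed.
Fact pscaleDl x : {morph pscale^~ x : a b / a + b}.
Proof.
by move=> a b; apply/prodP => i; rewrite ?(proj_add, mkprodE) scalerDl.
Qed.
HB.instance Definition _ := GRing.Zmodule_isLmodule.Build F prodalg
  pscaleA pscale1 pscaleDr pscaleDl.

Lemma proj_scale c x i : prod_proj (c *: x) i = c *: prod_proj x i.
Proof. exact: mkprodE. Qed.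

Fact pscaleAl (c : F) (x y : prodalg) : c *: (x * y) = (c *: x) * y.
Proof. by apply/prodP => i; rewrite !(proj_scale, proj_mul) scalerAl. Qed.
HB.instance Definition _ := GRing.Lmodule_isLalgebra.Build F prodalg pscaleAl.
Fact pscaleAr (c : F) (x y : prodalg) : c *: (x * y) = x * (c *: y).
Proof. by apply/prodP => i; rewrite !(proj_scale, proj_mul) scalerAr. Qed.
HB.instance Definition _ := GRing.Lalgebra_isAlgebra.Build F prodalg pscaleAr.

Fact prodalg_vect :
  Vector.axiom (\sum_(i < n.+1) dim (Ei i)) prodalg.
Proof.
exists (fun x => \mxrow_i v2r (prod_proj x i)).
  move=> c x y; apply/mxrowP => i; rewrite mxrowK.
  have subZD (A B : 'M[F]_(1, \sum_(j < n.+1) dim (Ei j))) :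
      submxrow (c *: A + B) i = c *: submxrow A i + submxrow B i.
    by apply/matrixP => a b; rewrite !mxE.
  by rewrite subZD !mxrowK proj_add proj_scale linearP.
exists (fun v => mkprod (fun i => r2v (submxrow v i))).
  by move=> x; apply/prodP => i; rewrite mkprodE mxrowK v2rK.
by move=> v; apply/mxrowP => i; rewrite mxrowK mkprodE r2vK.
Qed.
HB.instance Definition _ := Lmodule_hasFinDim.Build F prodalg prodalg_vect.
HB.instance Definition _ := Algebra_isFalgebra.Build F prodalg.

Definition prod_idem (i : 'I_n.+1) : prodalg :=
  mkprod (fun j => if j == i then 1 else 0).

End ProdAlg.

Section Bimodules.
Variable F : fieldType.

(* Linearity over [F] in both arguments makes [F] act centrally.              *)
Record bimod_on (R S : algType F) (U : lmodType F) := BimodOn {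
  bon_l : R -> U -> U;
  bon_r : U -> S -> U;
  bon_ll : forall u, linear (bon_l^~ u);
  bon_lr : forall r, linear (bon_l r);
  bon_rl : forall s, linear (bon_r^~ s);
  bon_rr : forall u, linear (bon_r u);
  bon_l1 : forall u, bon_l 1 u = u;
  bon_lA : forall r r' u, bon_l r (bon_l r' u) = bon_l (r * r') u;
  bon_r1 : forall u, bon_r u 1 = u;
  bon_rA : forall u s s', bon_r (bon_r u s) s' = bon_r u (s * s');
  bon_lrA : forall r u s, bon_r (bon_l r u) s = bon_l r (bon_r u s)
}.

Record bimod (R S : algType F) := Bimod {
  bimod_sort :> lmodType F;
  bimod_str : bimod_on R S bimod_sort
}.

Definition lact (R S : algType F) (U : bimod R S) : R -> U -> U :=
  bon_l (bimod_str U).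
Definition ract (R S : algType F) (U : bimod R S) : U -> S -> U :=
  bon_r (bimod_str U).

Record fdbimod (R S : algType F) := FdBimod {
  fdbimod_sort :> vectType F;
  fdbimod_str : bimod_on R S fdbimod_sort
}.
Coercion bimod_of_fd (R S : algType F) (U : fdbimod R S) : bimod R S :=
  Bimod (fdbimod_str U).
Canonical bimod_of_fd.

Definition is_bimod_iso (R S : algType F) (U V : bimod R S) (f : U -> V) :=
  [/\ linear f,
      forall r u, f (lact r u) = lact r (f u),
      forall u s, f (ract u s) = ract (f u) s
    & bijective f].

Section AlgBimod.
Variables (R S A : algType F).
Variables (f : {lrmorphism R -> A}) (g : {lrmorphism S -> A}).

Let alact (r : R) (a : A) : A := f r * a.
Let aract (a : A) (s : S) : A := a * g s.

Fact alact_linl a : linear (alact^~ a).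
Proof. by move=> c x y; rewrite /alact linearP mulrDl scalerAl. Qed.
Fact alact_lin r : linear (alact r).
Proof. by move=> c x y; rewrite /alact mulrDr scalerAr. Qed.
Fact aract_lin s : linear (aract^~ s).
Proof. by move=> c x y; rewrite /aract mulrDl scalerAl. Qed.
Fact aract_linr a : linear (aract a).
Proof. by move=> c x y; rewrite /aract linearP mulrDr scalerAr. Qed.
Fact alact_1 a : alact 1 a = a.
Proof. by rewrite /alact rmorph1 mul1r. Qed.
Fact alact_A r r' a : alact r (alact r' a) = alact (r * r') a.
Proof. by rewrite /alact rmorphM mulrA. Qed.
Fact aract_1 a : aract a 1 = a.
Proof. by rewrite /aract rmorph1 mulr1. Qed.
Fact aract_A a s s' : aract (aract a s) s' = aract a (s * s').
Proof. by rewrite /aract rmorphM mulrA. Qed.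
Fact alract_A r a s : aract (alact r a) s = alact r (aract a s).
Proof. by rewrite /alact /aract mulrA. Qed.

Definition alg_bimod : bimod R S :=
  Bimod (BimodOn alact_linl alact_lin aract_lin aract_linr
                 alact_1 alact_A aract_1 aract_A alract_A).

End AlgBimod.

End Bimodules.

Section Tensor.
Variables (F : fieldType) (R S T : algType F) (U : bimod R S) (V : bimod S T).

Definition balanced (W : lmodType F) (b : U -> V -> W) :=
  [/\ forall v, linear (b^~ v), forall u, linear (b u)
    & forall u s v, b (ract u s) v = b u (lact s v)].

Definition tsum (W : lmodType F) (b : U -> V -> W) (x : seq (U * V)) : W :=
  \sum_(p <- x) b p.1 p.2.

(* Two formal sums of pure tensors are identified when no balanced map        *)
(* distinguishes them, so the universal property holds by construction.       *)
Definition teq (x y : seq (U * V)) : bool :=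
  `[< forall (W : lmodType F) (b : U -> V -> W),
        balanced b -> tsum b x = tsum b y >].

Fact teq_refl : reflexive teq.
Proof. by move=> x; apply/asboolP. Qed.
Fact teq_sym : symmetric teq.
Proof.
by move=> x y; apply/asboolP/asboolP => h W b bb; rewrite (h W b bb).
Qed.
Fact teq_trans : transitive teq.
Proof.
move=> y x z /asboolP h1 /asboolP h2; apply/asboolP => W b bb.
by rewrite (h1 W b bb) (h2 W b bb).
Qed.
Definition teq_equiv := EquivRel teq teq_refl teq_sym teq_trans.

Definition tensor : Type := {eq_quot teq_equiv}.
HB.instance Definition _ := Choice.on tensor.

Definition tclass (x : seq (U * V)) : tensor := \pi_({eq_quot teq_equiv}) x.
Definition trepr (t : tensor) : seq (U * V) :=
  repr (t : {eq_quot teq_equiv}).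
Definition tpure (u : U) (v : V) : tensor := tclass [:: (u, v)].

(* Independent of the chosen representative only when [b] is balanced.        *)
Definition tlift (W : lmodType F) (b : U -> V -> W) (t : tensor) : W :=
  tsum b (trepr t).

Lemma tclassK t : tclass (trepr t) = t.
Proof. exact: reprK. Qed.

Lemma tlift_class (W : lmodType F) (b : U -> V -> W) x :
  balanced b -> tlift b (tclass x) = tsum b x.
Proof.
move=> bb; rewrite /tlift /trepr /tclass.
have /eqmodP/asboolP := reprK (\pi_({eq_quot teq_equiv}) x).
exact.
Qed.

Lemma tlift_pure (W : lmodType F) (b : U -> V -> W) u v :
  balanced b -> tlift b (tpure u v) = b u v.
Proof. by move=> bb; rewrite tlift_class // /tsum big_seq1. Qed.

Lemma tensor_ext (t t' : tensor) :
  (forall (W : lmodType F) (b : U -> V -> W),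
     balanced b -> tlift b t = tlift b t') -> t = t'.
Proof.
move=> h; rewrite -(tclassK t) -(tclassK t').
by apply/eqmodP/asboolP => W b bb; have := h W b bb.
Qed.

Let tadd (t t' : tensor) := tclass (trepr t ++ trepr t').
Let tzero : tensor := tclass [::].
Let tscale (c : F) (t : tensor) :=
  tclass [seq (c *: p.1, p.2) | p <- trepr t].

Section Lift.
Variables (W : lmodType F) (b : U -> V -> W) (bb : balanced b).

Fact tlift_add0 t t' : tlift b (tadd t t') = tlift b t + tlift b t'.
Proof. by rewrite tlift_class // /tsum big_cat. Qed.
Fact tlift_zero0 : tlift b tzero = 0.
Proof. by rewrite tlift_class // /tsum big_nil. Qed.
Fact tlift_scale0 c t : tlift b (tscale c t) = c *: tlift b t.
Proof.
rewrite tlift_class // /tsum big_map scaler_sumr.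
by case: bb => bl _ _; apply: eq_bigr => p _; apply: (scalable_linear (bl p.2)).
Qed.
End Lift.
Let tE := (tlift_add0, tlift_zero0, tlift_scale0).

Fact tadd_A : associative tadd.
Proof. by move=> x y z; apply: tensor_ext => W b bb; rewrite !tE // addrA. Qed.
Fact tadd_C : commutative tadd.
Proof. by move=> x y; apply: tensor_ext => W b bb; rewrite !tE // addrC. Qed.
Fact tadd_0 : left_id tzero tadd.
Proof. by move=> x; apply: tensor_ext => W b bb; rewrite !tE // add0r. Qed.
Fact tadd_N : left_inverse tzero (tscale (-1)) tadd.
Proof.
by move=> x; apply: tensor_ext => W b bb; rewrite !tE // scaleN1r addNr.
Qed.
HB.instance Definition _ :=
  GRing.isZmodule.Build tensor tadd_A tadd_C tadd_0 tadd_N.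

Fact tscaleA a b x : tscale a (tscale b x) = tscale (a * b) x.
Proof. by apply: tensor_ext => W d bd; rewrite !tE // scalerA. Qed.
Fact tscale1 : left_id 1 tscale.
Proof. by move=> x; apply: tensor_ext => W d bd; rewrite !tE // scale1r. Qed.
Fact tscaleDr : right_distributive tscale +%R.
Proof.
by move=> a x y; apply: tensor_ext => W d bd; rewrite !tE // scalerDr.
Qed.
Fact tscaleDl x : {morph tscale^~ x : a b / a + b}.
Proof.
by move=> a b; apply: tensor_ext => W d bd; rewrite !tE // scalerDl.
Qed.
HB.instance Definition _ := GRing.Zmodule_isLmodule.Build F tensor
  tscaleA tscale1 tscaleDr tscaleDl.

Lemma tlift_linear (W : lmodType F) (b : U -> V -> W) :
  balanced b -> linear (tlift b).
Proof.
move=> bb c x y; apply: etrans (tlift_add0 bb (c *: x) y) _.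
by congr (_ + _); apply: tlift_scale0.
Qed.

Lemma tpure_balanced : balanced tpure.
Proof.
split=> [v c u u'|u c v v'|u s v]; apply: tensor_ext => W b bb;
  rewrite ?(tlift_linear bb) !tlift_pure //; case: bb => bl br bs.
- exact: bl.
- exact: br.
- exact: bs.
Qed.

Lemma tsum_pure t : t = tsum tpure (trepr t).
Proof.
apply: tensor_ext => W b bb; rewrite {1}/tlift /tsum.
elim: (trepr t) => [|p x IHx].
  by rewrite !big_nil; apply/esym/tlift_zero0.
by rewrite !big_cons IHx -(tlift_pure p.1 p.2 bb); apply/esym/tlift_add0.
Qed.

Lemma tensor_ind (P : tensor -> Prop) :
  P 0 -> (forall u v t, P t -> P (tpure u v + t)) -> forall t, P t.
Proof.
move=> P0 PD t; rewrite [t]tsum_pure /tsum.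
by elim: (trepr t) => [|p x IHx]; rewrite (big_nil, big_cons) //; apply: PD.
Qed.

Lemma tensor_lin_ext (W : lmodType F) (f g : tensor -> W) :
  linear f -> linear g ->
  (forall u v, f (tpure u v) = g (tpure u v)) -> f =1 g.
Proof.
move=> lf lg h; elim/tensor_ind => [|u v t IHt].
  have lin0 (k : tensor -> W) : linear k -> k 0 = 0.
    by move=> /scalable_linear lk; have := lk 0 0; rewrite /= !scale0r.
  by rewrite !lin0.
by rewrite -[tpure u v]scale1r lf lg h IHt.
Qed.

Definition tlact (r : R) : tensor -> tensor :=
  tlift (fun u v => tpure (lact r u) v).
Definition tract (t : tensor) (s : T) : tensor :=
  tlift (fun u v => tpure u (ract v s)) t.

Fact tlact_bal r : balanced (fun u v => tpure (lact r u) v).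
Proof.
have [bl br bs] := tpure_balanced; split=> [v c u u'|u c v v'|u s v].
- by rewrite /lact bon_lr bl.
- by rewrite br.
- by rewrite -bs /lact /ract bon_lrA.
Qed.
Fact tract_bal s : balanced (fun u v => tpure u (ract v s)).
Proof.
have [bl br bs] := tpure_balanced; split=> [v c u u'|u c v v'|u s' v].
- by rewrite bl.
- by rewrite /ract bon_rl br.
- by rewrite bs /lact /ract bon_lrA.
Qed.

Lemma tlact_pure r u v : tlact r (tpure u v) = tpure (lact r u) v.
Proof. by rewrite /tlact tlift_pure //; apply: tlact_bal. Qed.
Lemma tract_pure u v s : tract (tpure u v) s = tpure u (ract v s).
Proof. by rewrite /tract tlift_pure //; apply: tract_bal. Qed.

Fact linear_comp0 (A B C : lmodType F) (f : B -> C) (g : A -> B) :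
  linear f -> linear g -> linear (fun x => f (g x)).
Proof. by move=> lf lg c x y; rewrite lg lf. Qed.
Fact linear_comb0 (A B : lmodType F) (c : F) (f g : A -> B) :
  linear f -> linear g -> linear (fun x => c *: f x + g x).
Proof.
move=> lf lg d x y; rewrite lf lg !scalerDr !scalerA [c * d]mulrC.
by rewrite -!addrA; congr (_ + _); rewrite addrCA.
Qed.

Fact tlact_lin r : linear (tlact r).
Proof. by apply: tlift_linear; apply: tlact_bal. Qed.
Fact tract_lin s : linear (tract^~ s).
Proof. by apply: tlift_linear; apply: tract_bal. Qed.

Fact tlact_linl t : linear (tlact^~ t).
Proof.
move=> c r r'; move: t; apply: tensor_lin_ext => [||u v].
- exact: tlact_lin.
- by apply: linear_comb0; apply: tlact_lin.
- have [bl _ _] := tpure_balanced.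
  by rewrite !tlact_pure /lact bon_ll bl.
Qed.
Fact tract_linr t : linear (tract t).
Proof.
move=> c s s'; move: t; apply: (@tensor_lin_ext _ (tract^~ _)) => [||u v].
- exact: tract_lin.
- by apply: linear_comb0; apply: tract_lin.
- have [_ br _] := tpure_balanced.
  by rewrite !tract_pure /ract bon_rr br.
Qed.
Fact tlact_1 t : tlact 1 t = t.
Proof.
move: t; apply: tensor_lin_ext => [||u v]; [exact: tlact_lin|by []|].
by rewrite tlact_pure /lact bon_l1.
Qed.
Fact tlact_A r r' t : tlact r (tlact r' t) = tlact (r * r') t.
Proof.
move: t; apply: (@tensor_lin_ext _ (fun t => tlact r (tlact r' t))) => [||u v].
- by apply: linear_comp0; apply: tlact_lin.
- exact: tlact_lin.
- by rewrite !tlact_pure /lact bon_lA.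
Qed.
Fact tract_1 t : tract t 1 = t.
Proof.
move: t; apply: (@tensor_lin_ext _ (tract^~ _)) => [||u v];
  [exact: tract_lin|by []|].
by rewrite tract_pure /ract bon_r1.
Qed.
Fact tract_A t s s' : tract (tract t s) s' = tract t (s * s').
Proof.
move: t; apply: (@tensor_lin_ext _ (fun t => tract (tract t s) s')) => [||u v].
- by apply: (@linear_comp0 _ _ _ (tract^~ _) (tract^~ _)); apply: tract_lin.
- exact: tract_lin.
- by rewrite !tract_pure /ract bon_rA.
Qed.
Fact tlract_A r t s : tract (tlact r t) s = tlact r (tract t s).
Proof.
move: t; apply: (@tensor_lin_ext _ (fun t => tract (tlact r t) s)) => [||u v].
- apply: (@linear_comp0 _ _ _ (tract^~ _)); first exact: tract_lin.
  exact: tlact_lin.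
- apply: (@linear_comp0 _ _ _ _ (tract^~ _)); first exact: tlact_lin.
  exact: tract_lin.
- by rewrite !(tlact_pure, tract_pure).
Qed.

Definition tensor_bimod : bimod R T :=
  Bimod (BimodOn tlact_linl tlact_lin tract_lin tract_linr
                 tlact_1 tlact_A tract_1 tract_A tlract_A).

End Tensor.

Section TensorAlgebra.
Variables (F : fieldType) (E : algType F) (M : bimod E E).

(* [tpow i.+1] is [M (x)_E tpow i], so degree [1] is [M (x)_E E], identified  *)
(* with [M] by [m |-> m (x) 1] (see [fts_M] and [tens_M]).                     *)
Fixpoint tpow (i : nat) : bimod E E :=
  if i is j.+1 then tensor_bimod M (tpow j) else @alg_bimod F E E E idfun idfun.

Fixpoint tmul (i j : nat) : tpow i -> tpow j -> tpow (i + j) :=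
  match i return tpow i -> tpow j -> tpow (i + j) with
  | 0 => fun s y => lact (s : E) y
  | k.+1 => fun x y =>
      @tlift _ _ _ _ M (tpow k) _ (fun m x' => tpure m (tmul x' y)) x
  end.

Definition fts : Type := forall i, tpow i.
HB.instance Definition _ := Choice.copy fts (forall i, tpow i).

(* The element whose only nonzero component is [x], in degree [i].            *)
Definition homog (i : nat) (x : tpow i) : fts :=
  fun l => if i =P l is ReflectT e then ecast l (tpow l) e x else 0.

Definition fts_mul (f g : fts) : fts :=
  fun l => \sum_(s < l.+1) homog (tmul (f s) (g (l - s)%N)) l.
Definition fts_one : fts := homog (1 : tpow 0).

Lemma ftsP (f g : fts) : (forall l, f l = g l) -> f = g.
Proof. exact: functional_extensionality_dep. Qed.

Let fadd (f g : fts) : fts := fun l => f l + g l.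
Let fopp (f : fts) : fts := fun l => - f l.
Let fzero : fts := fun l => 0.
Let fscale (c : F) (f : fts) : fts := fun l => c *: f l.

Fact fadd_A : associative fadd.
Proof. by move=> f g h; apply: ftsP => l; rewrite /fadd addrA. Qed.
Fact fadd_C : commutative fadd.
Proof. by move=> f g; apply: ftsP => l; rewrite /fadd addrC. Qed.
Fact fadd_0 : left_id fzero fadd.
Proof. by move=> f; apply: ftsP => l; rewrite /fadd add0r. Qed.
Fact fadd_N : left_inverse fzero fopp fadd.
Proof. by move=> f; apply: ftsP => l; rewrite /fadd addNr. Qed.
HB.instance Definition _ :=
  GRing.isZmodule.Build fts fadd_A fadd_C fadd_0 fadd_N.

Fact fscaleA a b f : fscale a (fscale b f) = fscale (a * b) f.
Proof. by apply: ftsP => l; rewrite /fscale scalerA. Qed.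
Fact fscale1 : left_id 1 fscale.
Proof. by move=> f; apply: ftsP => l; rewrite /fscale scale1r. Qed.
Fact fscaleDr : right_distributive fscale +%R.
Proof. by move=> a f g; apply: ftsP => l; apply: scalerDr. Qed.
Fact fscaleDl f : {morph fscale^~ f : a b / a + b}.
Proof. by move=> a b; apply: ftsP => l; apply: scalerDl. Qed.
HB.instance Definition _ := GRing.Zmodule_isLmodule.Build F fts
  fscaleA fscale1 fscaleDr fscaleDl.

Lemma ftsD (f g : fts) l : (f + g) l = f l + g l. Proof. by []. Qed.
Lemma ftsN (f : fts) l : (- f) l = - f l. Proof. by []. Qed.
Lemma fts0 l : (0 : fts) l = 0. Proof. by []. Qed.
Lemma ftsZ c (f : fts) l : (c *: f) l = c *: f l. Proof. by []. Qed.

Lemma homog_id i (x : tpow i) : homog x i = x.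
Proof. by rewrite /homog; case: eqP => // e; rewrite (eq_irrelevance e erefl). Qed.
Lemma homog_neq i (x : tpow i) l : i <> l -> homog x l = 0.
Proof. by rewrite /homog; case: eqP. Qed.
Lemma homog_linear i : linear (@homog i).
Proof.
move=> c x y; apply: ftsP => l; rewrite ftsD ftsZ /homog.
by case: eqP => [e|_]; [case: l / e|rewrite scaler0 addr0].
Qed.
HB.instance Definition _ i :=
  GRing.isLinear.Build F (tpow i) fts *:%R (@homog i) (@homog_linear i).

Fact tmul_lact_bal i j (y : tpow j) :
  (forall x : tpow i, forall r, tmul (lact r x) y = lact r (tmul x y)) ->
  (linear (fun x : tpow i => tmul x y)) ->
  @balanced _ _ _ _ M (tpow i) _ (fun m x' => tpure m (tmul x' y)).
Proof.
move=> hl hL; have [bl br bs] := @tpure_balanced _ _ _ _ M (tpow (i + j)).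
split=> [v c u u'|u c v v'|u s v].
- exact: bl.
- by rewrite hL br.
- by rewrite bs hl.
Qed.

Fact tpow_ext i (W : lmodType F) (f g : tpow i.+1 -> W) :
  linear f -> linear g ->
  (forall m (x : tpow i), f (tpure m x) = g (tpure m x)) -> f =1 g.
Proof. exact: tensor_lin_ext. Qed.

Fact tmul_aux i j (y : tpow j) :
  linear (fun x : tpow i => tmul x y) /\
  (forall x : tpow i, forall r, tmul (lact r x) y = lact r (tmul x y)).
Proof.
elim: i => [|i [IHl IHr]].
  split=> [c s s'|s r] /=; first by rewrite /lact bon_ll.
  by rewrite [in RHS]/lact bon_lA.
have bb := tmul_lact_bal IHr IHl.
split=> [|x r]; first exact: (tlift_linear bb).
move: x; apply: (@tpow_ext i (tpow (i + j).+1)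
  (fun x => tmul (lact r x) y) (fun x => lact r (tmul x y))) => [||m x].
- move=> c u v; have e := bon_lr (bimod_str (tpow i.+1)) r c u v.
  exact: etrans (congr1 (fun t : tpow i.+1 => tmul t y) e) (tlift_linear bb c _ _).
- move=> c u v; have e := tlift_linear bb c u v.
  apply: etrans (congr1 (fun t : tpow (i + j).+1 => lact r t) e) _.
  exact: (bon_lr (bimod_str (tpow (i + j).+1)) r).
- have e : lact r (tpure m x : tpow i.+1) = tpure (lact r m) x :> tpow i.+1.
    exact: tlact_pure.
  have e1 m' : tmul (tpure m' x : tpow i.+1) y
      = tpure m' (tmul x y) :> tpow (i + j).+1 by exact: (tlift_pure m' x bb).
  rewrite e !e1; apply/esym; exact: tlact_pure.
Qed.

Lemma tmul_linl i j (y : tpow j) : linear (fun x : tpow i => tmul x y).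
Proof. by case: (tmul_aux i y). Qed.
Lemma tmul_lact i j r (x : tpow i) (y : tpow j) :
  tmul (lact r x) y = lact r (tmul x y).
Proof. by case: (tmul_aux i y). Qed.
Lemma tmul_bal i j (y : tpow j) :
  @balanced _ _ _ _ M (tpow i) _ (fun m x' => tpure m (tmul x' y)).
Proof. by case: (tmul_aux i y) => h1 h2; apply: tmul_lact_bal. Qed.

Lemma tmul_pure i j m (x : tpow i) (y : tpow j) :
  tmul (tpure m x : tpow i.+1) y = tpure m (tmul x y) :> tpow (i + j).+1.
Proof. by rewrite /= tlift_pure //; apply: tmul_bal. Qed.

Lemma tmul_linr i j (x : tpow i) : linear (fun y : tpow j => tmul x y).
Proof.
elim: i x => [|i IHi] x c y y'; first by rewrite /= /lact bon_lr.
move: x; apply: (@tpow_ext i (tpow (i + j).+1)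
  (fun x => tmul x (c *: y + y'))
  (fun x => c *: tmul x y + tmul x y'))
  => [||m x].
- exact: tmul_linl.
- by apply: linear_comb0; apply: tmul_linl.
- rewrite !tmul_pure IHi.
  by have [_ br _] := @tpure_balanced _ _ _ _ M (tpow (i + j)); rewrite br.
Qed.

HB.instance Definition _ i j (x : tpow i) :=
  GRing.isLinear.Build F (tpow j) (tpow (i + j)) *:%R
    (tmul x) (@tmul_linr i j x).

Fact tmulDl i j (x x' : tpow i) (y : tpow j) :
  tmul (x + x') y = tmul x y + tmul x' y.
Proof. by rewrite -[x in LHS]scale1r tmul_linl scale1r. Qed.
Fact tmul0l i j (y : tpow j) : tmul (0 : tpow i) y = 0.
Proof. by apply: (addrI (tmul (0 : tpow i) y)); rewrite -tmulDl !addr0. Qed.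
Fact tmulZl i j c (x : tpow i) (y : tpow j) : tmul (c *: x) y = c *: tmul x y.
Proof. by rewrite -[c *: x in LHS]addr0 tmul_linl tmul0l addr0. Qed.
Fact tmul_suml I (r : seq I) (P : pred I) i j (x : I -> tpow i) (y : tpow j) :
  tmul (\sum_(k <- r | P k) x k) y = \sum_(k <- r | P k) tmul (x k) y.
Proof. by elim/big_rec2: _ => [|k u v _ <-]; rewrite (tmul0l, tmulDl). Qed.

Let shift (m : M) (f : fts) : fts :=
  fun l => if l is k.+1 then tpure m (f k) : tpow k.+1 else 0.

Fact homog_pure i m (x : tpow i) :
  homog (tpure m x : tpow i.+1) = shift m (homog x).
Proof.
apply: ftsP => -[|l] /=; first by rewrite homog_neq.
have [e|ne] := eqVneq i l; first by subst l; rewrite !homog_id.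
rewrite !homog_neq; [|exact/eqP|by case=> /eqP; apply/negP].
have [_ br _] := @tpure_balanced _ _ _ _ M (tpow l).
by have /scalable_linear := br m => /(_ 0 0) /=; rewrite !scale0r.
Qed.

Lemma homog_tmulA i j k (x : tpow i) (y : tpow j) (z : tpow k) :
  homog (tmul (tmul x y) z) = homog (tmul x (tmul y z)).
Proof.
elim: i x => [|i IHi] x; first by rewrite [tmul x y]/= tmul_lact.
move: x; apply: (@tpow_ext i fts
  (fun x => homog (tmul (tmul x y) z))
  (fun x => homog (tmul x (tmul y z)))) => [||m x].
- apply: (@linear_comp0 _ _ _ _ (@homog _)); first exact: homog_linear.
  apply: (@linear_comp0 _ _ _ _ (fun t => tmul t z) (fun t => tmul t y));
    exact: tmul_linl.
- apply: (@linear_comp0 _ _ _ _ (@homog _)); first exact: homog_linear.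
  exact: tmul_linl.
- by rewrite !tmul_pure !homog_pure IHi.
Qed.

Lemma tmul1l i (x : tpow i) : tmul (1 : tpow 0) x = x.
Proof. by rewrite /= /lact bon_l1. Qed.
Lemma homog_tmul1r i (x : tpow i) : homog (tmul x (1 : tpow 0)) = homog x.
Proof.
elim: i x => [|i IHi] x; first by rewrite /= /lact /= mulr1.
move: x; apply: (@tpow_ext i fts
  (fun x => homog (tmul x (1 : tpow 0)))
  (fun x => homog x)) => [||m x].
- apply: (@linear_comp0 _ _ _ _ (@homog _)); first exact: homog_linear.
  exact: tmul_linl.
- exact: homog_linear.
- by rewrite !tmul_pure !homog_pure IHi.
Qed.

Lemma fts_mulE N (f g : fts) l : (l < N)%N ->
  fts_mul f g l = \sum_(i < N) \sum_(j < N) homog (tmul (f i) (g j)) l.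
Proof.
move=> lN; rewrite /fts_mul.
rewrite (big_ord_widen _ (fun s => homog (tmul (f s) (g (l - s)%N)) l) lN).
rewrite big_mkcond; apply: eq_bigr => i _.
case: ifP => [|]; rewrite ltnS => il.
  have jN : (l - i < N)%N by apply: leq_ltn_trans lN; apply: leq_subr.
  rewrite (bigD1 (Ordinal jN)) //= big1 ?addr0 // => j /eqP nj.
  rewrite homog_neq // => e; apply: nj; apply: val_inj => /=.
  by rewrite -e addKn.
rewrite big1 // => j _; rewrite homog_neq // => e.
by move: il; rewrite -e leq_addr.
Qed.

Fact homog_absorbl N n k (w : tpow n) (z : tpow k) l : (l < N)%N ->
  \sum_(a < N) homog (tmul (homog w a) z) l = homog (tmul w z) l.
Proof.
move=> lN; have [nN|Nn] := ltnP n N.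
  rewrite (bigD1 (Ordinal nN)) //= homog_id big1 ?addr0 // => a /eqP na.
  rewrite [homog w a]homog_neq; last by move=> e; apply: na; apply: val_inj.
  by rewrite tmul0l linear0.
rewrite [RHS]homog_neq; last first.
  by move=> e; move: lN; rewrite -e ltnNge (leq_trans Nn) ?leq_addr.
rewrite big1 // => a _; rewrite [homog w a]homog_neq.
  by rewrite tmul0l linear0.
by move=> e; move: (ltn_ord a); rewrite -e ltnNge Nn.
Qed.

Fact homog_absorbr N n k (w : tpow n) (z : tpow k) l : (l < N)%N ->
  \sum_(a < N) homog (tmul z (homog w a)) l = homog (tmul z w) l.
Proof.
move=> lN; have [nN|Nn] := ltnP n N.
  rewrite (bigD1 (Ordinal nN)) //= homog_id big1 ?addr0 // => a /eqP na.
  rewrite [homog w a]homog_neq; last by move=> e; apply: na; apply: val_inj.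
  by rewrite linear0 linear0.
rewrite [RHS]homog_neq; last first.
  by move=> e; move: lN; rewrite -e ltnNge (leq_trans Nn) ?leq_addl.
rewrite big1 // => a _; rewrite [homog w a]homog_neq.
  by rewrite linear0 linear0.
by move=> e; move: (ltn_ord a); rewrite -e ltnNge Nn.
Qed.

Lemma fts_sum I (r : seq I) (P : pred I) (f : I -> fts) l :
  (\sum_(i <- r | P i) f i) l = \sum_(i <- r | P i) f i l.
Proof. by elim/big_ind2: _ => // x1 x2 y1 y2 <- <-. Qed.

Fact fts_mulA : associative fts_mul.
Proof.
move=> f g h; apply: ftsP => l; have lN := ltnSn l; set N := l.+1 in lN *.
have -> : fts_mul f (fts_mul g h) l = \sum_(i < N) \sum_(j < N) \sum_(k < N)
    homog (tmul (f i) (tmul (g j) (h k))) l.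
  rewrite (fts_mulE _ _ lN); apply: eq_bigr => i _.
  transitivity (\sum_(a < N) \sum_(j < N) \sum_(k < N)
      homog (tmul (f i) (homog (tmul (g j) (h k)) a)) l).
    apply: eq_bigr => a _; rewrite (fts_mulE _ _ (ltn_ord a)).
    rewrite linear_sum linear_sum fts_sum; apply: eq_bigr => j _.
    by rewrite linear_sum linear_sum fts_sum.
  rewrite exchange_big; apply: eq_bigr => j _.
  by rewrite exchange_big; apply: eq_bigr => k _; rewrite homog_absorbr.
rewrite (fts_mulE _ _ lN); symmetry.
transitivity (\sum_(a < N) \sum_(i < N) \sum_(j < N) \sum_(k < N)
    homog (tmul (homog (tmul (f i) (g j)) a) (h k)) l).
  apply: eq_bigr => a _; rewrite (fts_mulE _ _ (ltn_ord a)).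
  transitivity (\sum_(k < N) \sum_(i < N) \sum_(j < N)
     homog (tmul (homog (tmul (f i) (g j)) a) (h k)) l).
    apply: eq_bigr => k _.
    rewrite tmul_suml linear_sum fts_sum.
    apply: eq_bigr => i _.
    by rewrite tmul_suml linear_sum fts_sum.
  rewrite exchange_big; apply: eq_bigr => i _.
  by rewrite exchange_big.
rewrite exchange_big; apply: eq_bigr => i _.
rewrite exchange_big; apply: eq_bigr => j _.
rewrite exchange_big; apply: eq_bigr => k _.
by rewrite homog_absorbl // homog_tmulA.
Qed.

Fact fts_mul1 : left_id fts_one fts_mul.
Proof.
move=> f; apply: ftsP => l; rewrite /fts_mul big_ord_recl big1.
  have e : homog (tmul (fts_one 0) (f (l - 0)%N)) l = f l.
    by rewrite [fts_one _]homog_id tmul1l subn0 homog_id.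
  by rewrite addr0; apply: e.
move=> i _; rewrite [fts_one _]homog_neq //.
by rewrite tmul0l linear0.
Qed.

Fact fts_mulr1 : right_id fts_one fts_mul.
Proof.
move=> f; apply: ftsP => l; rewrite (fts_mulE _ _ (ltnSn l)).
transitivity (\sum_(i < l.+1) homog (f i) l).
  apply: eq_bigr => i _.
  by rewrite (homog_absorbr (1 : tpow 0) (f i) (ltnSn l)) homog_tmul1r.
rewrite big_ord_recr /= homog_id big1 ?add0r // => i _.
by rewrite homog_neq // => e; move: (ltn_ord i); rewrite /= e ltnn.
Qed.

Fact fts_mulDl : left_distributive fts_mul +%R.
Proof.
move=> f g h; apply: ftsP => l; rewrite ftsD /fts_mul -big_split /=.
apply: eq_bigr => s _; rewrite ftsD.
by rewrite tmulDl linearD.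
Qed.
Fact fts_mulDr : right_distributive fts_mul +%R.
Proof.
move=> f g h; apply: ftsP => l; rewrite ftsD /fts_mul -big_split /=.
by apply: eq_bigr => s _; rewrite ftsD linearD linearD.
Qed.
Fact fts_one_neq0 : fts_one != 0.
Proof.
apply/eqP => e; have := congr1 (fun f : fts => f 0%N) e.
rewrite /fts_one /= homog_id; apply/eqP; exact: (oner_neq0 E).
Qed.
HB.instance Definition _ := GRing.Zmodule_isNzRing.Build fts
  fts_mulA fts_mul1 fts_mulr1 fts_mulDl fts_mulDr fts_one_neq0.

Fact fts_scaleAl (c : F) (f g : fts) : c *: (f * g) = (c *: f) * g.
Proof.
apply: ftsP => l; rewrite ftsZ scaler_sumr; apply: eq_bigr => s _.
by rewrite ftsZ tmulZl linearZ.
Qed.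
HB.instance Definition _ := GRing.Lmodule_isLalgebra.Build F fts fts_scaleAl.
Fact fts_scaleAr (c : F) (f g : fts) : c *: (f * g) = f * (c *: g).
Proof.
apply: ftsP => l; rewrite ftsZ scaler_sumr; apply: eq_bigr => s _.
by rewrite ftsZ linearZ linearZ.
Qed.
HB.instance Definition _ := GRing.Lalgebra_isAlgebra.Build F fts fts_scaleAr.

Definition fts_E (s : E) : fts := homog (s : tpow 0).
Definition fts_M (m : M) : fts := homog (tpure m (1 : tpow 0) : tpow 1).

Lemma homog_mul i j (x : tpow i) (y : tpow j) :
  homog x * homog y = homog (tmul x y).
Proof.
apply: ftsP => l; rewrite [LHS](fts_mulE _ _ (ltnSn l)).
under eq_bigr do rewrite (homog_absorbr _ _ (ltnSn l)).
by rewrite homog_absorbl.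
Qed.

Definition fin_supp : {pred fts} :=
  fun f => `[< exists N, forall i, (N <= i)%N -> f i = 0 >].

Lemma homog_fin_supp i (x : tpow i) : homog x \in fin_supp.
Proof.
apply/asboolP; exists i.+1 => l il; rewrite homog_neq // => e.
by move: il; rewrite e ltnn.
Qed.

Fact fin_supp_closed : subalg_closed fin_supp.
Proof.
split=> [|c f g /asboolP[Nf hf] /asboolP[Ng hg]|
          f g /asboolP[Nf hf] /asboolP[Ng hg]]; first exact: homog_fin_supp.
  apply/asboolP; exists (maxn Nf Ng) => i; rewrite geq_max => /andP[hi1 hi2].
  by rewrite ftsD ftsZ hf // hg // scaler0 addr0.
apply/asboolP; exists (Nf + Ng)%N => l hl; apply: big1 => s _.
have [sf|fs] := leqP Nf s.
  by rewrite hf // tmul0l linear0.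
rewrite hg ?linear0 //; rewrite leq_subRL; last by rewrite -ltnS.
by apply: leq_trans hl; rewrite leq_add2r ltnW.
Qed.
HB.instance Definition _ :=
  GRing.isSubalgClosed.Build F fts fin_supp fin_supp_closed.

Record tensalg := TensAlg { tensalg_val : fts; _ : tensalg_val \in fin_supp }.
HB.instance Definition _ := [isSub for tensalg_val].
HB.instance Definition _ := [Choice of tensalg by <:].
HB.instance Definition _ := [SubChoice_isSubAlgebra of tensalg by <:].

Definition thom (i : nat) (x : tpow i) : tensalg := TensAlg (homog_fin_supp x).
Definition tens_E (s : E) : tensalg := thom (s : tpow 0).
Definition tens_M (m : M) : tensalg := thom (tpure m (1 : tpow 0) : tpow 1).

Fact tens_E_linear : linear tens_E.
Proof. by move=> c x y; apply: val_inj; rewrite /= homog_linear. Qed.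
Fact tens_E_monoid : monoid_morphism tens_E.
Proof. by split=> [|x y]; apply: val_inj; rewrite /= ?homog_mul. Qed.
HB.instance Definition _ :=
  GRing.isLinear.Build F E tensalg *:%R tens_E tens_E_linear.
HB.instance Definition _ :=
  GRing.isMonoidMorphism.Build E tensalg tens_E tens_E_monoid.

End TensorAlgebra.

Section Semisimple.
Variables (F : fieldType) (A : falgType F).

Definition left_ideal (U : {vspace A}) : Prop :=
  forall a u, u \in U -> a * u \in U.

(* Semisimplicity of the left regular module.                                 *)
Definition semisimple : Prop :=
  forall U : {vspace A}, left_ideal U ->
    exists V : {vspace A},
      [/\ left_ideal V, (U + V = fullv)%VS & (U :&: V = 0)%VS].

End Semisimple.

Section Potentials.
Variables (F : fieldType) (n : nat) (Ei : 'I_n.+1 -> falgType F).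
Local Notation E := (prodalg Ei).
Local Notation e := (prod_idem Ei).

Definition Zspan : {vspace E} := (\sum_(i < n.+1) <[e i]>)%VS.
Definition Zmem : {pred E} := fun x => x \in Zspan.

Lemma prod_idem_sum : \sum_(i < n.+1) e i = 1.
Proof.
apply/prodP => j; rewrite proj_one.
have projD : {morph (fun x : E => prod_proj x j) : x y / x + y}.
  by move=> x y; apply: proj_add.
rewrite (big_morph _ projD (proj_zero Ei j)) (bigD1 j) //= mkprodE eqxx.
by rewrite big1 ?addr0 // => i /negPf ij; rewrite mkprodE eq_sym ij.
Qed.

Lemma prod_idemM i j : e i * e j = if i == j then e i else 0.
Proof.
apply/prodP => k; rewrite proj_mul !mkprodE.
case: (eqVneq k i) => [->|ki]; last first.
  by rewrite mul0r; case: ifP; rewrite ?mkprodE ?(negPf ki) ?proj_zero.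
by rewrite mul1r; case: eqP => _; rewrite ?mkprodE ?eqxx ?proj_zero.
Qed.

Lemma ZmemP x : reflect (exists c : 'I_n.+1 -> F, x = \sum_i c i *: e i)
                        (x \in Zmem).
Proof.
apply: (iffP memv_sumP) => [[v hv ->]|[c ->]].
  have hc i : exists c, v i = c *: e i by apply/vlineP/hv.
  exists (fun i => sval (cid (hc i))).
  by apply: eq_bigr => i _; apply: svalP (cid (hc i)).
by exists (fun i => c i *: e i) => // i _; rewrite memvZ ?memv_line.
Qed.

Fact Zmem_closed : subalg_closed Zmem.
Proof.
split=> [|c x y Zx Zy|x y /ZmemP[a ->] /ZmemP[b ->]].
- apply/ZmemP; exists (fun=> 1); rewrite -prod_idem_sum.
  by apply: eq_bigr => i _; rewrite scale1r.
- by rewrite /Zmem -topredE /= memvD ?memvZ.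
- apply/ZmemP; exists (fun i => a i * b i).
  rewrite mulr_suml; apply: eq_bigr => i _.
  rewrite mulr_sumr (bigD1 i) //= big1 ?addr0 => [|j /negPf ji].
    by rewrite -scalerAl -scalerAr prod_idemM eqxx scalerA.
  by rewrite -scalerAl -scalerAr prod_idemM eq_sym ji !scaler0.
Qed.
HB.instance Definition _ := GRing.isSubalgClosed.Build F E Zmem Zmem_closed.

Record Zalg := InZ { zval : E; _ : zval \in Zmem }.
HB.instance Definition _ := [isSub for zval].
HB.instance Definition _ := [Choice of Zalg by <:].
HB.instance Definition _ := [SubChoice_isSubAlgebra of Zalg by <:].
Fact zval_linear : linear zval.
Proof. exact: (linearP (val : Zalg -> E)). Qed.
Fact zval_monoid : monoid_morphism zval.
Proof. split; [exact: (rmorph1 (val : Zalg -> E))|exact: (rmorphM (val : Zalg -> E))]. Qed.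
HB.instance Definition _ :=
  GRing.isLinear.Build F Zalg E *:%R zval zval_linear.
HB.instance Definition _ :=
  GRing.isMonoidMorphism.Build Zalg E zval zval_monoid.

Section ZFree.
Variables (M : fdbimod E E) (M0 : {vspace M}).

Definition Zstable : Prop :=
  forall (z : Zalg) (m : M), m \in M0 ->
    lact (zval z) m \in M0 /\ ract m (zval z) \in M0.

Section SubBimod.
Hypothesis stable : Zstable.

Let zl (z : Zalg) (m : subvs_of M0) : subvs_of M0 :=
  vsproj M0 (lact (zval z) (vsval m)).
Let zr (m : subvs_of M0) (z : Zalg) : subvs_of M0 :=
  vsproj M0 (ract (vsval m) (zval z)).

Let vsvalP c (x y : subvs_of M0) :
  vsval (c *: x + y) = c *: vsval x + vsval y.
Proof. exact: linearP. Qed.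
Let ZvalP c (x y : Zalg) : zval (c *: x + y) = c *: zval x + zval y.
Proof. exact: linearP. Qed.
Let Zval1 : zval (1 : Zalg) = 1 :> E. Proof. exact: rmorph1. Qed.
Let ZvalM (x y : Zalg) : zval (x * y) = zval x * zval y. Proof. exact: rmorphM. Qed.

Fact zlE z m : vsval (zl z m) = lact (zval z) (vsval m).
Proof. by rewrite vsprojK //; case: (stable z (subvsP m)). Qed.
Fact zrE m z : vsval (zr m z) = ract (vsval m) (zval z).
Proof. by rewrite vsprojK //; case: (stable z (subvsP m)). Qed.

Fact zl_linl m : linear (zl^~ m).
Proof.
move=> c z z'; apply: subvs_inj.
by rewrite vsvalP !zlE /lact ZvalP bon_ll.
Qed.
Fact zl_lin z : linear (zl z).
Proof.
by move=> c m m'; apply: subvs_inj; rewrite vsvalP !zlE /lact vsvalP bon_lr.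
Qed.
Fact zr_lin z : linear (zr^~ z).
Proof.
by move=> c m m'; apply: subvs_inj; rewrite vsvalP !zrE /ract vsvalP bon_rl.
Qed.
Fact zr_linr m : linear (zr m).
Proof.
move=> c z z'; apply: subvs_inj.
by rewrite vsvalP !zrE /ract ZvalP bon_rr.
Qed.
Fact zl_1 m : zl 1 m = m.
Proof. by apply: subvs_inj; rewrite zlE Zval1 /lact bon_l1. Qed.
Fact zl_A z z' m : zl z (zl z' m) = zl (z * z') m.
Proof. by apply: subvs_inj; rewrite !zlE ZvalM /lact bon_lA. Qed.
Fact zr_1 m : zr m 1 = m.
Proof. by apply: subvs_inj; rewrite zrE Zval1 /ract bon_r1. Qed.
Fact zr_A m z z' : zr (zr m z) z' = zr m (z * z').
Proof. by apply: subvs_inj; rewrite !zrE ZvalM /ract bon_rA. Qed.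
Fact zlr_A z m z' : zr (zl z m) z' = zl z (zr m z').
Proof.
by apply: subvs_inj; rewrite !(zlE, zrE) /lact /ract bon_lrA.
Qed.

Definition Zsub_bimod : bimod Zalg Zalg :=
  Bimod (BimodOn zl_linl zl_lin zr_lin zr_linr zl_1 zl_A zr_1 zr_A zlr_A).

Definition E_EZ : bimod E Zalg := @alg_bimod F E Zalg E idfun zval.
Definition E_ZE : bimod Zalg E := @alg_bimod F Zalg E E zval idfun.

Definition EM0E : bimod E E :=
  tensor_bimod (tensor_bimod E_EZ Zsub_bimod) E_ZE.

Definition EM0E_mul : EM0E -> M :=
  tlift (U := tensor_bimod E_EZ Zsub_bimod) (V := E_ZE)
    (fun t b => ract (tlift (U := E_EZ) (V := Zsub_bimod)
                        (fun a m => lact (a : E) (vsval m : M)) t) (b : E)).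

Lemma E_M0_mul_balanced :
  @balanced _ _ _ _ E_EZ Zsub_bimod M
    (fun a m => lact (a : E) (vsval m : M)).
Proof.
split=> [m c a a'|a c m m'|a z m]; rewrite /= /lact.
- exact: bon_ll.
- exact: etrans (congr1 (bon_l _ (a : E)) (vsvalP c m m')) (bon_lr _ _ _ _ _).
- by rewrite /= zlE /lact bon_lA.
Qed.

Lemma EM0E_mul_balanced :
  @balanced _ _ _ _ (tensor_bimod E_EZ Zsub_bimod) E_ZE M
    (fun t b => ract (tlift (U := E_EZ) (V := Zsub_bimod)
                        (fun a m => lact (a : E) (vsval m : M)) t) (b : E)).
Proof.
have bal := E_M0_mul_balanced.
set f := tlift _; have lf : linear f := tlift_linear bal.
have fz z t : f (tract t z) = ract (f t) (zval z).
  move: t; apply: (@tensor_lin_ext _ _ _ _ E_EZ Zsub_bimod M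
    (fun t => f (tract t z)) (fun t => ract (f t) (zval z))) => [||a m].
  + by move=> c t t'; rewrite (tract_lin z c t t') lf.
  + by move=> c t t'; rewrite lf /ract bon_rl.
  + rewrite tract_pure /f !tlift_pure //.
    exact: etrans (congr1 (bon_l _ (a : E)) (zrE m z)) (esym (bon_lrA _ _ _ _)).
split=> [b c t t'|t c b b'|t z b].
- by rewrite /= lf /ract bon_rl.
- exact: bon_rr.
- exact: etrans (congr1 (fun x => bon_r _ x (b : E)) (fz z t)) (bon_rA _ _ _ _).
Qed.

End SubBimod.

Definition Zfree_generator : Prop :=
  exists stable : Zstable, is_bimod_iso (@EM0E_mul stable).

Local Notation A' := (tensalg M).

Definition T_TZ : bimod A' Zalg :=
  @alg_bimod F A' Zalg A' idfun (@tens_E F E M \o zval).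
Definition T_ZT : bimod Zalg A' :=
  @alg_bimod F Zalg A' A' (@tens_E F E M \o zval) idfun.
Definition TT : bimod A' A' := tensor_bimod T_TZ T_ZT.

Definition ttens (a b : A') : TT := @tpure F A' Zalg A' T_TZ T_ZT a b.

Definition is_Delta (D : A' -> TT) : Prop :=
  [/\ linear D,
      forall a b, D (a * b) = ract (D a) b + lact a (D b),
      forall s : E, D (tens_E M s) = ttens 1 (tens_E M s) - ttens (tens_E M s) 1
    & forall m : M, m \in M0 -> D (tens_M m) = ttens 1 (tens_M m)].

Definition cyc_u : TT -> A' :=
  @tlift F A' Zalg A' T_TZ T_ZT A' (fun a b : A' =>
    \sum_(i < n.+1) tens_E M (e i) * b * a * tens_E M (e i)).

Lemma cyc_u_balanced :
  @balanced F A' Zalg A' T_TZ T_ZT A' (fun a b : A' =>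
    \sum_(i < n.+1) tens_E M (e i) * b * a * tens_E M (e i)).
Proof.
split=> [b c a a'|a c b b'|a z b] /=.
- rewrite scaler_sumr -big_split; apply: eq_bigr => i _ /=.
  by rewrite mulrDr mulrDl -scalerAr -scalerAl.
- rewrite scaler_sumr -big_split; apply: eq_bigr => i _ /=.
  by rewrite mulrDr !mulrDl -scalerAr -!scalerAl.
- apply: eq_bigr => i _; rewrite /ract /lact /= !mulrA.
  have [c zE] : exists c, e i * zval z = c *: e i /\ zval z * e i = c *: e i.
    case: z => z /= /ZmemP[c ->]; exists (c i); split.
      rewrite mulr_sumr (bigD1 i) //= big1 ?addr0 => [|j /negPf ji].
        by rewrite -scalerAr prod_idemM eqxx.
      by rewrite -scalerAr prod_idemM eq_sym ji scaler0.
    rewrite mulr_suml (bigD1 i) //= big1 ?addr0 => [|j /negPf ji].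
      by rewrite -scalerAl prod_idemM eqxx.
    by rewrite -scalerAl prod_idemM ji scaler0.
  rewrite -[LHS]mulrA -rmorphM -[X in _ = X * b * a * _]rmorphM.
  have tZ x : tens_E M (c *: x) = c *: tens_E M x by exact: linearZ.
  by case: zE => ze ez; rewrite /= ze ez !tZ -!scalerAl -scalerAr.
Qed.

Variable D : A' -> TT.

Definition cyc_h0 (f g : A') : A' := cyc_u (ract (D f) g).

(* [cyc_h0] maps homogeneous elements of degrees [i] and [j] to a homogeneous *)
(* element of degree [i + j], so taking the component of degree [l] below     *)
(* discards nothing.                                                          *)
Definition cyc_h (f g : fts M) : fts M := fun l =>
  \sum_(i < l.+1) tensalg_val (cyc_h0 (thom (f i)) (thom (g (l - i)%N))) l.

Definition cyc_delta (f : fts M) : fts M := cyc_h f 1.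

Definition right_linear (psi : M -> E) : Prop :=
  linear psi /\ forall m s, psi (ract m s) = psi m * s.

(* [m_1 m_2 ... m_l |-> psi(m_1) m_2 ... m_l], and [E] is mapped to [0].      *)
Definition psi_ext (psi : M -> E) (f : fts M) : fts M := fun l =>
  @tlift F E E E M (tpow M l) (tpow M l) (fun m x => lact (psi m) x) (f l.+1).

Lemma psi_ext_balanced psi l : right_linear psi ->
  @balanced F E E E M (tpow M l) (tpow M l) (fun m x => lact (psi m) x).
Proof.
case=> lpsi rpsi; split=> [x c m m'|m c x x'|m s x]; rewrite /lact.
- by rewrite lpsi bon_ll.
- exact: bon_lr.
- by rewrite rpsi bon_lA.
Qed.

Definition cyc_delta_psi (psi : M -> E) (f : fts M) : fts M :=
  psi_ext psi (cyc_delta f).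

Definition potential (P : fts M) : Prop :=
  P = \sum_(i < n.+1) fts_E M (e i) * P * fts_E M (e i).

Definition peirce (i j : 'I_n.+1) : {vspace M} :=
  (linfun (fun m : M => ract (lact (e i) m) (e j)) @: M0)%VS.

Variables (L : 'I_n.+1 -> seq E) (B : 'I_n.+1 -> 'I_n.+1 -> seq M).

Definition is_dual (star : M -> E -> M -> E) : Prop :=
  forall (i j : 'I_n.+1) (a : M) (s : E), a \in B i j -> s \in L i ->
  [/\ right_linear (star a s),
      star a s (lact s a) = e j
    & forall (i' j' : 'I_n.+1) (a' : M) (s' : E),
        a' \in B i' j' -> s' \in L i' -> (a', s') <> (a, s) ->
        star a s (lact s' a') = 0].

Variable star : M -> E -> M -> E.

Definition Xelt (i : 'I_n.+1) (a : M) (P : fts M) : fts M :=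
  \sum_(s <- L i) cyc_delta_psi (star a s) P * fts_E M s.

Definition two_sided_ideal (I : set (fts M)) : Prop :=
  [/\ I 0, forall f g, I f -> I g -> I (f + g)
    & forall f g, I f -> I (g * f) /\ I (f * g)].

(* [2 ^ - nu (f - g)], where [nu 0] is infinite.                              *)
Definition fts_dist (f g : fts M) : rat :=
  if pselect (exists i, (f - g) i != 0) is left h then 2%:R ^- ex_minn h else 0.

Definition fts_closure (I : set (fts M)) : set (fts M) :=
  [set f | forall eps : rat, 0 < eps -> exists2 g, I g & fts_dist f g < eps].

Definition Rideal (P : fts M) : set (fts M) :=
  fts_closure (smallest two_sided_ideal
    [set x | exists i j a, a \in B i j /\ x = Xelt i a P]).

End ZFree.

End Potentials.

(* Main.v *)
Require Import Defs.
From HB Require Import structures.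
From mathcomp Require Import all_boot all_order all_algebra falgebra.
From mathcomp Require Import generic_quotient boolp classical_sets.

Set Implicit Arguments.
Unset Strict Implicit.
Unset Printing Implicit Defensive.
Import Order.TTheory GRing.Theory Num.Theory.
Local Open Scope ring_scope.
Local Open Scope classical_set_scope.

(** Write [a] for a basis element of [e_i M0 e_j] and [d_a f x] for the sum,
    over all factorisations [f = p a q] of the words of [f], of the rotated
    words [e_j q x p e_i].  Then [d_a] satisfies the cyclic Leibniz rule
      [d (f g) x = d f (g x) + d g (x f)],
    it vanishes on [E], and [X_{a^*}(P) = d_a P 1].  Call an operation [c] with
    this rule, vanishing on [E], lowering degrees by at most one in [f] and
    mapping every closed ideal into itself in [x], a cyclic derivation.

    The theorem holds because [R(P)] is the closed ideal generated by the values
    [c P 1] of _all_ cyclic derivations [c], a description that mentions no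
    basis and no generator [M0].  On the one hand every [d_a] is a cyclic
    derivation ([cyc_partial_cder]).  On the other hand, comparing values on the
    basis elements gives the chain rule
      [c f x = sum_a c a (d_a f x)]   ([cder_expand]),
    and [c a] maps the closed ideal [R(P)] into itself, so that [c P 1] lies in
    [R(P)] ([cder_Rideal]).  If [psi] is the inverse of [phi], conjugation by
    [phi] turns a cyclic derivation [c] of one algebra into the cyclic
    derivation [psi (c (phi f) (phi x))] of the other ([cder_transport]), and
    the two inclusions follow.

    The operation [d_a] is [cyc_partial i a], that is [d_a f x = G (h f x)],
    where [h] is the bilinear operation built from [Delta] and [G] is the map
    [contract i a : f |-> sum_s (s a)^*(f) s]; for [x = 1] this is the definition
    of [X_{a^*}].  The Leibniz rule for [d_a] is inherited from [h], where it
    holds because [Delta] is a derivation and [u] a trace ([cyc_u_rot]).  The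
    values on generators follow from [G (r z) = G (z r)] for [r] in [E]
    ([contract_trace]): [h m x] is [sum_k e_k m x e_k] for [m] in [M0] and [h s x]
    is the corner sum of the commutator [s x - x s] for [s] in [E], while [G]
    ignores corner sums and kills such commutators.

    Transport needs [phi] to respect the degree filtration, which is where
    semisimplicity enters.  The constant terms of the [phi m], [m] in [M], form
    a two-sided ideal of [E].  Its component in [E_i] would contain a nonzero
    idempotent [k] if it were nonzero, but [1 - m] is invertible by the
    geometric series, so [1 - k] would be right invertible and [k = 0]
    ([const_part0]).  As the series of order at least [k + 1] are the finite
    sums [sum_i m_i g_i] with [(m_i)] a basis of [M] and [g_i] of order at
    least [k], the filtration is preserved ([over_E_Fil]). *)

(** * Bimodules and tensor products *)
Section Bimod.
Variables (F : fieldType) (R S : algType F) (U : bimod R S).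
Implicit Types (u v : U) (r : R) (s : S).

Lemma lactDr r u v : lact r (u + v) = lact r u + lact r v.
Proof. by have := bon_lr (bimod_str U) r 1 u v; rewrite !scale1r. Qed.
Lemma lact0r r : lact r (0 : U) = 0.
Proof. by apply: (addrI (lact r (0 : U))); rewrite -lactDr !addr0. Qed.
Lemma ractDl u v s : ract (u + v) s = ract u s + ract v s.
Proof. by have := bon_rl (bimod_str U) s 1 u v; rewrite !scale1r. Qed.
Lemma ract0l s : ract (0 : U) s = 0.
Proof. by apply: (addrI (ract (0 : U) s)); rewrite -ractDl !addr0. Qed.
Lemma lactDl r r' u : lact (r + r') u = lact r u + lact r' u.
Proof. by have := bon_ll (bimod_str U) u 1 r r'; rewrite !scale1r. Qed.
Lemma lactZl c r u : lact (c *: r) u = c *: lact r u.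
Proof. exact: (scalable_linear (bon_ll (bimod_str U) u) c r). Qed.
Lemma ractDr u s s' : ract u (s + s') = ract u s + ract u s'.
Proof. by have := bon_rr (bimod_str U) u 1 s s'; rewrite !scale1r. Qed.
Lemma lact1 u : lact 1 u = u. Proof. exact: bon_l1. Qed.
Lemma ract1 u : ract u 1 = u. Proof. exact: bon_r1. Qed.
Lemma lactA r r' u : lact r (lact r' u) = lact (r * r') u.
Proof. exact: bon_lA. Qed.
Lemma ractA u s s' : ract (ract u s) s' = ract u (s * s').
Proof. exact: bon_rA. Qed.
Lemma lractA r u s : ract (lact r u) s = lact r (ract u s).
Proof. exact: bon_lrA. Qed.
End Bimod.

Section Pure.
Variables (F : fieldType) (R S T : algType F) (U : bimod R S) (V : bimod S T).
Implicit Types (u : U) (v : V).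
Lemma tpureDl u u' v : tpure (u + u') v = tpure u v + tpure u' v.
Proof. by have [bl _ _] := tpure_balanced U V; have := bl v 1 u u'; rewrite !scale1r. Qed.
Lemma tpureDr u v v' : tpure u (v + v') = tpure u v + tpure u v'.
Proof. by have [_ bl _] := tpure_balanced U V; have := bl u 1 v v'; rewrite !scale1r. Qed.
Lemma tpureZ c u v : tpure (c *: u) v = tpure u (c *: v).
Proof.
have [bl br _] := tpure_balanced U V.
by rewrite [LHS](scalable_linear (bl v)) [RHS](scalable_linear (br u)).
Qed.
Lemma tpure0r u : tpure u (0 : V) = 0.
Proof. by apply: (addrI (tpure u (0 : V))); rewrite -tpureDr !addr0. Qed.
Lemma tpure0l v : tpure (0 : U) v = 0.
Proof. by apply: (addrI (tpure (0 : U) v)); rewrite -tpureDl !addr0. Qed.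
Lemma tpure_ract u s v : tpure (ract u s) v = tpure u (lact s v).
Proof. by have [_ _ ->] := tpure_balanced U V. Qed.
End Pure.

(** * The degree filtration *)
Section Filtration.
Variables (F : fieldType) (E : algType F) (M : bimod E E).
Implicit Types (f g x : fts M) (s : E) (m : M).

Definition Fil (k : nat) : set (fts M) :=
  [set f | forall l, (l < k)%N -> f l = 0].

Lemma FilD k f g : Fil k f -> Fil k g -> Fil k (f + g).
Proof. by move=> hf hg l lk; rewrite ftsD hf ?hg ?addr0. Qed.
Lemma FilN k f : Fil k f -> Fil k (- f).
Proof. by move=> hf l lk; rewrite ftsN hf ?oppr0. Qed.
Lemma Fil_sum k (I : Type) (r : seq I) (P : pred I) (f : I -> fts M) :
  (forall i, P i -> Fil k (f i)) -> Fil k (\sum_(i <- r | P i) f i).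
Proof.
by move=> h; elim/big_ind: _ => //; apply: FilD.
Qed.
Lemma FilT f : Fil 0 f. Proof. by []. Qed.
Lemma Fil_sep f : (forall k, Fil k f) -> f = 0.
Proof. by move=> h; apply: ftsP => l; apply: (h l.+1). Qed.
Lemma Fil_inj f g : (forall k, Fil k (f - g)) -> f = g.
Proof. by move=> h; apply/subr0_eq/Fil_sep. Qed.

Lemma ftsM f g l :
  (f * g) l = \sum_(s < l.+1) homog (tmul (f s) (g (l - s)%N)) l.
Proof. by []. Qed.

Lemma FilM p q f g : Fil p f -> Fil q g -> Fil (p + q) (f * g).
Proof.
move=> hf hg l lpq; rewrite ftsM big1 // => s _.
have [sp|ps] := ltnP s p; first by rewrite hf // tmul0l linear0.
rewrite hg ?linear0 // ltn_subLR; last by rewrite -ltnS.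
by apply: leq_trans lpq _; rewrite leq_add2r.
Qed.
Lemma FilMl k f g : Fil k g -> Fil k (f * g).
Proof. by move=> hg; apply: (FilM (FilT f) hg). Qed.
Lemma FilMr k f g : Fil k f -> Fil k (f * g).
Proof. by move=> hf; rewrite -[k]addn0; apply: (FilM hf (FilT g)). Qed.

Lemma homog_Fil i (u : tpow M i) : Fil i (homog u).
Proof. by move=> l li; rewrite homog_neq // => e; rewrite e ltnn in li. Qed.

Lemma fts_EM s t : fts_E M s * fts_E M t = fts_E M (s * t).
Proof. exact: homog_mul. Qed.
Lemma fts_ED s t : fts_E M (s + t) = fts_E M s + fts_E M t.
Proof. exact: (raddfD (@homog F E M 0)). Qed.
Lemma fts_E0 : fts_E M 0 = 0.
Proof. exact: (raddf0 (@homog F E M 0)). Qed.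
Lemma fts_E1 : fts_E M 1 = 1. Proof. by []. Qed.
Lemma fts_EZ c s : fts_E M (c *: s) = c *: fts_E M s.
Proof. exact: (scalable_linear (@homog_linear F E M 0) c s). Qed.
Lemma fts_MD m m' : fts_M (m + m') = fts_M m + fts_M m'.
Proof. by rewrite /fts_M tpureDl [LHS](raddfD (@homog F E M 1)). Qed.
Lemma fts_M0 : fts_M (0 : M) = 0.
Proof. by apply: (addrI (fts_M (0 : M))); rewrite -fts_MD !addr0. Qed.

(** Only the summand [s = i] of the Cauchy product survives. *)
Lemma homog_mulE i (u : tpow M i) f l :
  (homog u * f) l = if (i <= l)%N then homog (tmul u (f (l - i)%N)) l else 0.
Proof.
rewrite ftsM; case: ifP => il.
  have il' : (i < l.+1)%N by rewrite ltnS.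
  rewrite (bigD1 (Ordinal il')) //= homog_id big1 ?addr0 // => s /eqP ns.
  rewrite [homog u _]homog_neq ?tmul0l ?linear0 // => e; apply: ns.
  by apply: val_inj; rewrite /= e.
rewrite big1 // => s _; rewrite [homog u _]homog_neq ?tmul0l ?linear0 // => e.
by move: (ltn_ord s); rewrite -e ltnS il.
Qed.

Lemma fts_E_mulE s f l : (fts_E M s * f) l = lact s (f l).
Proof.
rewrite homog_mulE.
suff h k : k = l -> homog (lact s (f k)) l = lact s (f l) by exact: h (subn0 l).
by move=> ->; rewrite homog_id.
Qed.

Lemma fts_M_mul0 m f : (fts_M m * f) 0%N = 0.
Proof. by rewrite homog_mulE. Qed.
Lemma fts_M_mulS m f l : (fts_M m * f) l.+1 = tpure m (f l).
Proof.
rewrite homog_mulE ltnS leq0n tmul_pure tmul1l.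
suff h k : k = l -> homog (tpure m (f k) : tpow M k.+1) l.+1 = tpure m (f l).
  by apply: h; rewrite subn1.
by move=> ->; apply: (@homog_id F E M l.+1).
Qed.

Lemma fts_mul_0 f g : (f * g) 0%N = (f 0%N : E) * (g 0%N : E).
Proof. by rewrite ftsM big_ord1 [LHS]homog_id. Qed.

Lemma fts_M_lact s m : fts_M (lact s m) = fts_E M s * fts_M m.
Proof. by rewrite /fts_M /fts_E homog_mul; congr homog; apply/esym/tlact_pure. Qed.
Lemma fts_M_ract m s : fts_M (ract m s) = fts_M m * fts_E M s.
Proof.
rewrite /fts_M /fts_E homog_mul tmul_pure; congr homog.
by rewrite tpure_ract; congr tpure; rewrite /= /lact /= mulr1 mul1r.
Qed.
Lemma homog_pureM i m (u : tpow M i) :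
  homog (tpure m u : tpow M i.+1) = fts_M m * homog u.
Proof. by rewrite homog_mul tmul_pure tmul1l. Qed.
Lemma fts_M_Fil m : Fil 1 (fts_M m). Proof. exact: homog_Fil. Qed.
Lemma fts_E_id s : fts_E M s 0%N = s. Proof. exact: homog_id. Qed.

End Filtration.

(** * Polynomials and truncation *)
Section TensAlg.
Variables (F : fieldType) (E : algType F) (M : bimod E E).
Implicit Types (f g : fts M) (t u : tensalg M).

Lemma tvalD t u : tensalg_val (t + u) = tensalg_val t + tensalg_val u.
Proof. exact: (raddfD (val : tensalg M -> fts M)). Qed.
Lemma tval0 : tensalg_val (0 : tensalg M) = 0.
Proof. exact: (raddf0 (val : tensalg M -> fts M)). Qed.
Lemma tvalM t u : tensalg_val (t * u) = tensalg_val t * tensalg_val u.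
Proof. exact: (rmorphM (val : tensalg M -> fts M)). Qed.
Lemma tvalB t u : tensalg_val (t - u) = tensalg_val t - tensalg_val u.
Proof. exact: (raddfB (val : tensalg M -> fts M)). Qed.
Lemma tval_sum (I : Type) (r : seq I) (P : pred I) (f : I -> tensalg M) :
  tensalg_val (\sum_(i <- r | P i) f i) = \sum_(i <- r | P i) tensalg_val (f i).
Proof. exact: (raddf_sum (val : tensalg M -> fts M)). Qed.

Lemma thomD i (x y : tpow M i) : thom (x + y) = thom x + thom y.
Proof. by apply: val_inj; rewrite /= [LHS]raddfD. Qed.
Lemma thom0 i : thom (0 : tpow M i) = 0.
Proof. by apply: (addrI (thom (0 : tpow M i))); rewrite -thomD !addr0. Qed.
Lemma thom_pure i (m : M) (x : tpow M i) :
  thom (tpure m x : tpow M i.+1) = tens_M m * thom x.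
Proof. by apply: val_inj; rewrite /= homog_pureM. Qed.
Lemma tens_M_lact s (m : M) : tens_M (lact s m) = tens_E M s * tens_M m.
Proof. by apply: val_inj; rewrite /= [LHS]fts_M_lact. Qed.
Lemma tens_M_ract (m : M) s : tens_M (ract m s) = tens_M m * tens_E M s.
Proof. by apply: val_inj; rewrite /= [LHS]fts_M_ract. Qed.
Lemma tens_MD (m m' : M) : tens_M (m + m') = tens_M m + tens_M m'.
Proof. by apply: val_inj; rewrite /= [LHS]fts_MD. Qed.
Lemma tens_M0 : tens_M (0 : M) = 0.
Proof. by apply: (addrI (tens_M (0 : M))); rewrite -tens_MD !addr0. Qed.

Definition trunc k f : tensalg M := \sum_(i < k) thom (f i).

Lemma sum_homogE k f l : (\sum_(i < k) homog (f i)) l = if (l < k)%N then f l else 0.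
Proof.
rewrite fts_sum; case: ifP => lk.
  rewrite (bigD1 (Ordinal lk)) //= homog_id big1 ?addr0 // => i /eqP ni.
  by rewrite homog_neq // => e; apply: ni; apply: val_inj.
by rewrite big1 // => i _; rewrite homog_neq // => e; rewrite -e ltn_ord in lk.
Qed.

Lemma truncP k f : Fil k (f - tensalg_val (trunc k f)).
Proof.
move=> l lk; rewrite ftsD ftsN tval_sum /=.
by rewrite sum_homogE lk subrr.
Qed.

Lemma tensalgE t : exists k, t = trunc k (tensalg_val t).
Proof.
case: t => f hf; have /asboolP[N hN] := hf; exists N; apply: val_inj.
rewrite /= tval_sum; apply: ftsP => l /=.
by rewrite sum_homogE; case: ltnP => // /hN ->.
Qed.

Lemma tensalg_homog_ind (Q : tensalg M -> Prop) :
  Q 0 -> (forall t u, Q t -> Q u -> Q (t + u)) ->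
  (forall i (x : tpow M i), Q (thom x)) -> forall t, Q t.
Proof.
move=> Q0 QD Qh t; have [k ->] := tensalgE t.
by rewrite /trunc; elim/big_ind: _.
Qed.
End TensAlg.

(** * Expansion along a basis of the bimodule *)
Section TensorBasis.
Variables (F : fieldType) (R S T : algType F) (M : fdbimod R S).

(** Scalars move across the tensor sign, so finitely many left factors, the same
    for all tensors, suffice; this uniformity is what allows a whole series to be
    written as a finite sum in [fts_decomp]. *)
Lemma tensor_basis (V : bimod S T) (t : tensor M V) :
  exists w : 'I_(\dim {:M}) -> V, t = \sum_(i < \dim {:M}) tpure ((vbasis {:M})`_i : M) (w i).
Proof.
elim/tensor_ind: t => [|u v t [w ->]].
  by exists (fun=> 0); rewrite big1 // => i _; rewrite tpure0r.
exists (fun i => coord (vbasis {:M}) i u *: v + w i).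
under [RHS]eq_bigr do rewrite tpureDr.
rewrite big_split /=; congr (_ + _).
rewrite [in LHS](coord_vbasis (memvf u)).
have tD : {morph (fun u : M => tpure u v) : x y / x + y} by move=> x y; apply: tpureDl.
rewrite (big_morph _ tD (tpure0l _ v)); apply: eq_bigr => i _.
by rewrite tpureZ.
Qed.

End TensorBasis.

(** * Closed ideals *)
Section ClosedIdeals.
Variables (F : fieldType) (n : nat) (Ei : 'I_n.+1 -> falgType F).
Local Notation E := (prodalg Ei).
Variables (M : fdbimod E E).
Implicit Types (f g : fts M) (I : set (fts M)).

(** Closed for the topology of the metric, by [fts_closureP]. *)
Definition closed_ideal I :=
  two_sided_ideal I /\
  forall f, (forall k, exists2 g, I g & Fil k (f - g)) -> I f.

Lemma Fil_closed_ideal k : closed_ideal (@Fil F E M k).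
Proof.
split=> [|f /(_ k)[g gk]].
  by split=> //; [apply: FilD|split; [apply: FilMl|apply: FilMr]].
by rewrite -[f in X in _ -> X](subrK g) => h; apply: FilD.
Qed.

Lemma fts_distP f g (k : nat) : Fil k (f - g) -> fts_dist f g <= 2%:R ^- k.
Proof.
move=> h; rewrite /fts_dist; case: pselect => [ex|_]; last first.
  by rewrite invr_ge0 exprn_ge0.
case: ex_minnP => m hm _.
have km : (k <= m)%N by rewrite leqNgt; apply/negP => /h e; rewrite e eqxx in hm.
by rewrite lef_pV2 ?posrE ?exprn_gt0 // ler_weXn2l.
Qed.
Lemma fts_dist_Fil f g (k : nat) : fts_dist f g < 2%:R ^- k -> Fil k (f - g).
Proof.
rewrite /fts_dist; case: pselect => [ex|nex] h l lk.
  move: h; case: ex_minnP => m hm hmin h.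
  apply/eqP/negPn/negP => /hmin ml.
  move: h; rewrite ltf_pV2 ?posrE ?exprn_gt0 // ltr_eXn2l // => km.
  by have := leq_trans lk (leq_trans (ltnW km) ml); rewrite ltnn.
by apply/eqP/negPn/negP => hl; apply: nex; exists l.
Qed.

Lemma fts_closureP I f :
  fts_closure I f <-> forall k, exists2 g, I g & Fil k (f - g).
Proof.
split=> [h k|h eps e0].
  have [|g Ig /fts_dist_Fil hg] := h (2%:R ^- k).
    by rewrite invr_gt0 exprn_gt0.
  by exists g.
have [k hk] : exists k : nat, 2%:R ^- k < eps :> rat.
  exists (Num.bound eps^-1).
  rewrite -[X in _ < X]invrK ltf_pV2 ?posrE ?exprn_gt0 ?invr_gt0 //.
  apply: upper_nthrootP; exact: leqnn.
have [g Ig hg] := h k; exists g => //.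
by apply: le_lt_trans (fts_distP hg) hk.
Qed.

Lemma closure_closed_ideal I : two_sided_ideal I -> closed_ideal (fts_closure I).
Proof.
case=> I0 ID IM; split.
  split.
  - by apply/fts_closureP => k; exists 0; rewrite // subr0.
  - move=> f g /fts_closureP hf /fts_closureP hg; apply/fts_closureP => k.
    have [f' If' hf'] := hf k; have [g' Ig' hg'] := hg k.
    by exists (f' + g'); [apply: ID|rewrite opprD addrACA; apply: FilD].
  - move=> f g /fts_closureP hf; split; apply/fts_closureP => k;
      have [f' If' hf'] := hf k.
    + exists (g * f'); first by case: (IM f' g If').
      by rewrite -mulrBr; apply: FilMl.
    + exists (f' * g); first by case: (IM f' g If').
      by rewrite -mulrBl; apply: FilMr.
move=> f h; apply/fts_closureP => k.
have [g /fts_closureP/(_ k)[g' Ig' hg'] hg] := h k; exists g' => //.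
by rewrite -[f](subrK g) -addrA; apply: FilD.
Qed.

Lemma closure_sub I f : I f -> fts_closure I f.
Proof. by move=> If; apply/fts_closureP => k; exists f => //; rewrite subrr. Qed.

Lemma smallest_two_sided (S : set (fts M)) :
  two_sided_ideal (smallest (@two_sided_ideal F n Ei M) S).
Proof.
split=> [I [[]]//|f g hf hg I hI|f g hf].
  by have [[_ ID _] _] := hI; apply: ID; [apply: hf|apply: hg].
by split=> I hI; have [[_ _ IM] _] := hI; case: (IM f g (hf I hI)).
Qed.

Lemma closed_ideal_sum I (J : Type) (r : seq J) (P : pred J) (f : J -> fts M) :
  closed_ideal I -> (forall i, P i -> I (f i)) -> I (\sum_(i <- r | P i) f i).
Proof. by case=> [[I0 ID _] _] h; elim/big_ind: _. Qed.

Lemma sub_closure_ideal (S I : set (fts M)) : closed_ideal I ->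
  S `<=` I -> fts_closure (smallest (@two_sided_ideal F n Ei M) S) `<=` I.
Proof.
move=> [I2 Ic] SI f /fts_closureP h; apply: Ic => k.
by have [g Sg hg] := h k; exists g => //; apply: Sg.
Qed.

(** The part of positive order is [M] times the whole algebra, as a finite sum:
    each component [f l.+1] is expanded along the same basis of [M]. *)
Lemma fts_decomp f : exists g : 'I_(\dim {:M}) -> fts M,
  f = fts_E M (f 0%N) + \sum_(i < \dim {:M}) fts_M ((vbasis {:M})`_i : M) * g i.
Proof.
pose w l := sval (cid (tensor_basis (f l.+1))).
have hw l : f l.+1 = \sum_(i < \dim {:M}) tpure ((vbasis {:M})`_i : M) (w l i).
  exact: svalP (cid (tensor_basis (f l.+1))).
exists (fun i l => w l i); apply: ftsP => -[|l]; rewrite ftsD fts_sum.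
  by rewrite fts_E_id big1 ?addr0 // => i _; rewrite fts_M_mul0.
rewrite /fts_E homog_neq // add0r [LHS]hw; apply: eq_bigr => i _.
by rewrite fts_M_mulS.
Qed.

(** The coefficients of [fts_decomp] below degree [k] multiply basis elements to
    zero components of [f], so they may be replaced by zero. *)
Lemma fts_decomp_Fil k f : Fil k.+1 f ->
  exists2 g : 'I_(\dim {:M}) -> fts M,
  f = \sum_(i < \dim {:M}) fts_M ((vbasis {:M})`_i : M) * g i & forall i, Fil k (g i).
Proof.
move=> hf; have [g hg] := fts_decomp f.
exists (fun i l => if (l < k)%N then 0 else g i l); last first.
  by move=> i l lk; rewrite lk.
apply: ftsP => -[|l]; rewrite fts_sum.
  by rewrite hf // big1 // => i _; rewrite fts_M_mul0.
have [lk|kl] := ltnP l k.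
  rewrite hf ?ltnS // big1 // => i _.
  by rewrite fts_M_mulS lk tpure0r.
rewrite hg ftsD /fts_E homog_neq // add0r fts_sum; apply: eq_bigr => i _.
by rewrite !fts_M_mulS ltnNge kl.
Qed.

(** The inverse is the geometric series, whose degree [l] part is finite. *)
Lemma Fil_geometric x : Fil 1 x -> exists y : fts M, (1 - x) * y = 1.
Proof.
move=> hx; pose S k : fts M := \sum_(i < k) x ^+ i.
have hxn k : Fil k (x ^+ k).
  elim: k => [|k IHk] //; rewrite exprS -add1n; exact: FilM.
have hS k l : (l < k)%N -> S k l = S l.+1 l.
  elim: k => // k IHk; rewrite ltnS leq_eqVlt => /orP[/eqP->//|lk].
  have -> : S k.+1 = S k + x ^+ k by apply: big_ord_recr.
  by rewrite ftsD IHk // (hxn k l lk) addr0.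
exists (fun l => S l.+1 l); apply: Fil_inj => k.
have e : (1 - x) * S k = 1 - x ^+ k.
  by rewrite /S -[in LHS]opprB mulNr -subrX1 opprB.
rewrite -[X in Fil k ((1 - x) * X - 1)](subrK (S k)) mulrDr e -addrA.
apply: FilD; last by rewrite addrAC subrr sub0r; apply: FilN.
by apply: FilMl => l lk; rewrite ftsD ftsN (hS _ _ lk) subrr.
Qed.

End ClosedIdeals.

(** * The cyclic Leibniz rule for polynomials *)
Section CyclicH.
Variables (F : fieldType) (n : nat) (Ei : 'I_n.+1 -> falgType F).
Local Notation E := (prodalg Ei).
Local Notation e := (prod_idem Ei).
Variables (M : fdbimod E E) (M0 : {vspace M}) (D : tensalg M -> TT M).
Hypothesis HD : is_Delta M0 D.
Local Notation A' := (tensalg M).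
Implicit Types (f g x : A') (s : E) (t : TT M).

Definition corner_sum (x : A') : A' :=
  \sum_(i < n.+1) tens_E M (e i) * x * tens_E M (e i).

Lemma cyc_uD t t' : cyc_u (t + t') = cyc_u t + cyc_u t'.
Proof.
have := tlift_linear (@cyc_u_balanced F n Ei M) 1 t t'.
by rewrite !scale1r.
Qed.
Lemma cyc_uZ c t : cyc_u (c *: t) = c *: cyc_u t.
Proof. exact: (scalable_linear (tlift_linear (@cyc_u_balanced F n Ei M)) c t). Qed.
Lemma cyc_u_pure a b : cyc_u (ttens a b) = corner_sum (b * a).
Proof.
rewrite /cyc_u /ttens tlift_pure; last exact: cyc_u_balanced.
by apply: eq_bigr => i _; rewrite !mulrA.
Qed.
Lemma ract_ttens (a b x : A') : ract (ttens a b) x = ttens a (b * x).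
Proof. exact: tract_pure. Qed.
Lemma lact_ttens (a b x : A') : lact x (ttens a b) = ttens (x * a) b.
Proof. exact: tlact_pure. Qed.

(** The trace property behind the cyclic Leibniz rule: [u] reads [a (x) b] as
    the cyclic word [b a], so a left factor of [a] can be moved to the right of
    [b]. *)
Lemma cyc_u_rot t f x : cyc_u (ract (lact f t) x) = cyc_u (ract t (x * f)).
Proof.
have lu : linear (@cyc_u F n Ei M) := tlift_linear (@cyc_u_balanced F n Ei M).
have ll := bon_lr (bimod_str (TT M)) f.
have lr y := bon_rl (bimod_str (TT M)) y.
have l1 : linear (fun t : TT M => cyc_u (ract (lact f t) x)).
  by move=> c t1 t2; rewrite /lact /ract ll lr lu.
have l2 : linear (fun t : TT M => cyc_u (ract t (x * f))).
  by move=> c t1 t2; rewrite /ract lr lu.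
move: t; apply: (tensor_lin_ext l1 l2) => a b.
change (cyc_u (ract (lact f (ttens a b)) x) = cyc_u (ract (ttens a b) (x * f))).
by rewrite lact_ttens !ract_ttens !cyc_u_pure !mulrA.
Qed.

Lemma cyc_h0_Dl f g x : cyc_h0 D (f + g) x = cyc_h0 D f x + cyc_h0 D g x.
Proof.
have [lD _ _ _] := HD; have := lD 1 f g; rewrite !scale1r => eD.
by rewrite /cyc_h0 eD ractDl cyc_uD.
Qed.
Lemma cyc_h0_Dr f x y : cyc_h0 D f (x + y) = cyc_h0 D f x + cyc_h0 D f y.
Proof. by rewrite /cyc_h0 ractDr cyc_uD. Qed.
Lemma cyc_h0_0l x : cyc_h0 D 0 x = 0.
Proof. by apply: (addrI (cyc_h0 D 0 x)); rewrite -cyc_h0_Dl !addr0. Qed.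
Lemma cyc_h0_0r f : cyc_h0 D f 0 = 0.
Proof. by apply: (addrI (cyc_h0 D f 0)); rewrite -cyc_h0_Dr !addr0. Qed.

Lemma cyc_h0M f g x :
  cyc_h0 D (f * g) x = cyc_h0 D f (g * x) + cyc_h0 D g (x * f).
Proof.
have [_ DM _ _] := HD.
by rewrite /cyc_h0 DM ractDl cyc_uD ractA cyc_u_rot.
Qed.

Lemma cyc_h0_E s x :
  cyc_h0 D (tens_E M s) x = corner_sum (tens_E M s * x - x * tens_E M s).
Proof.
have [_ _ DE _] := HD.
rewrite /cyc_h0 DE -scaleN1r ractDl cyc_uD.
have -> : ract (-1 *: ttens (tens_E M s) 1) x = -1 *: ttens (tens_E M s) x.
  have <- : ract (ttens (tens_E M s) 1) x = ttens (tens_E M s) x.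
    by rewrite ract_ttens mul1r.
  exact: (scalable_linear (bon_rl (bimod_str (TT M)) x)).
rewrite ract_ttens cyc_uZ !cyc_u_pure scaleN1r mulr1 /corner_sum -sumrB.
by apply: eq_bigr => i _; rewrite mulrBr mulrBl.
Qed.

Lemma cyc_h0_M (m : M) x : m \in M0 -> cyc_h0 D (tens_M m) x = corner_sum (tens_M m * x).
Proof.
by move=> mM; have [_ _ _ DM] := HD; rewrite /cyc_h0 DM // ract_ttens cyc_u_pure mulr1.
Qed.

End CyclicH.

(** * Generators of a Z-free bimodule *)
Section Spanning.
Variables (F : fieldType) (n : nat) (Ei : 'I_n.+1 -> falgType F).
Local Notation E := (prodalg Ei).
Local Notation e := (prod_idem Ei).

Lemma idem_central i (s : E) : s * e i = e i * s.
Proof.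
apply/prodP => k; rewrite !proj_mul !mkprodE.
by case: (k == i); rewrite ?(mulr1, mul1r, mulr0, mul0r).
Qed.
Lemma idem_id i : e i * e i = e i :> E.
Proof. by rewrite prod_idemM eqxx. Qed.

Variables (M : fdbimod E E) (M0 : {vspace M}).

(** Needed to evaluate [linfun] in the definition of [peirce]. *)
Lemma sandwich_linear i j : linear (fun m : M => ract (lact (e i) m) (e j) : M).
Proof. by move=> c x y; rewrite /ract /lact bon_lr bon_rl. Qed.

Lemma peirceP i j (m : M) : reflect
  (exists2 m0 : M, m0 \in M0 & m = ract (lact (e i) m0) (e j)) (m \in peirce M0 i j).
Proof.
pose f : {linear M -> M} := HB.pack (fun m : M => ract (lact (e i) m) (e j) : M)
  (GRing.isLinear.Build F M M *:%R _ (sandwich_linear i j)).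
apply: (iffP memv_imgP) => [[m0 h ->]|[m0 h ->]]; exists m0 => //.
  by rewrite (lfunE f).
by rewrite (lfunE f).
Qed.

Lemma peirce_id i j (m : M) : m \in peirce M0 i j ->
  lact (e i) m = m /\ ract m (e j) = m.
Proof.
case/peirceP=> m0 _ ->; split; first by rewrite -lractA lactA idem_id.
by rewrite ractA idem_id.
Qed.

Hypothesis freeM : Zfree_generator M0.
Variables (B : 'I_n.+1 -> 'I_n.+1 -> seq M).
Hypothesis HB : forall i j, basis_of (peirce M0 i j) (B i j).

(** Surjectivity of the multiplication map [E (x) M0 (x) E -> M]. *)
Lemma Zfree_ind (Q : M -> Prop) :
  Q 0 -> (forall m m', Q m -> Q m' -> Q (m + m')) ->
  (forall s (m : M) t, m \in M0 -> Q (ract (lact s m) t)) -> forall m, Q m.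
Proof.
move=> Q0 QD QM m; have [st [_ _ _ [g _ gK]]] := freeM.
rewrite -(gK m) /EM0E_mul /tlift /tsum; elim/big_ind: _ => // -[u t] _ /=.
have rD : {morph (fun u : M => ract u t) : x y / x + y} by move=> x y; apply: ractDl.
rewrite (big_morph _ rD (ract0l _ _)); elim/big_ind: _ => // -[s m0] _ /=.
by apply: QM; apply: subvsP.
Qed.

(** [M0] is the sum of its Peirce components [e_i M0 e_j], and the scalars of a
    basis expansion are absorbed by the left factor [s]. *)
Lemma Zfree_basis_ind (Q : M -> Prop) :
  Q 0 -> (forall m m', Q m -> Q m' -> Q (m + m')) ->
  (forall i j s (b : M) t, b \in B i j -> Q (ract (lact s b) t)) -> forall m, Q m.
Proof.
move=> Q0 QD QB; apply: Zfree_ind => // s m t mM.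
have Qs (I : Type) (r : seq I) (P : pred I) (f : I -> M) :
  (forall i, P i -> Q (f i)) -> Q (\sum_(i <- r | P i) f i).
  by move=> h; elim/big_ind: _.
have Em : m = \sum_i \sum_j ract (lact (e i) m) (e j).
  have lD : {morph (fun u : E => lact u m) : x y / x + y} by move=> x y; apply: lactDl.
  have rD (u : M) : {morph (fun s : E => ract u s) : x y / x + y}.
    by move=> x y; apply: ractDr.
  have l0 : lact (0 : E) m = 0.
    by apply: (addrI (lact 0 m)); rewrite -lactDl !addr0.
  have r0 (u : M) : ract u (0 : E) = 0.
    by apply: (addrI (ract u 0)); rewrite -ractDr !addr0.
  rewrite -{1}[m]lact1 -(prod_idem_sum Ei) (big_morph _ lD l0).
  apply: eq_bigr => i _.
  by rewrite -{1}[lact _ _]ract1 -(prod_idem_sum Ei) (big_morph _ (rD _) (r0 _)).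
pose g (u : M) : M := ract (lact s u) t.
have gD : {morph g : x y / x + y} by move=> x y; rewrite /g lactDr ractDl.
have g0 : g 0 = 0 by rewrite /g lact0r ract0l.
rewrite -/(g m) Em (big_morph _ gD g0); apply: (Qs) => i _.
rewrite (big_morph _ gD g0); apply: (Qs) => j _.
have : ract (lact (e i) m) (e j) \in peirce M0 i j by apply/peirceP; exists m.
rewrite -(span_basis (HB i j)) => /(coord_span (X := in_tuple (B i j))) ->.
rewrite (big_morph _ gD g0); apply: (Qs) => k _; set c := coord _ _ _.
have -> : g (c *: (B i j)`_k) = ract (lact (c *: s) (B i j)`_k) t.
  by rewrite /g lactZl; congr ract; apply: (scalable_linear (bon_lr (bimod_str M) s)).
by apply: (QB i j); apply: mem_nth.
Qed.

End Spanning.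

(** * Congruence up to a degree *)
Section Congruence.
Variables (F : fieldType) (E : algType F) (M : bimod E E).
Implicit Types (f g h : fts M).
Definition cong k f g : Prop := Fil k (f - g).
Lemma cong_refl k f : cong k f f. Proof. by rewrite /cong subrr. Qed.
Lemma cong_sym k f g : cong k f g -> cong k g f.
Proof. by move/FilN; rewrite /cong opprB. Qed.
Lemma cong_trans k g f h : cong k f g -> cong k g h -> cong k f h.
Proof. by move=> h1 h2; have := FilD h1 h2; rewrite addrA subrK. Qed.
Lemma congD k f f' g g' : cong k f f' -> cong k g g' -> cong k (f + g) (f' + g').
Proof. by move=> h1 h2; have := FilD h1 h2; rewrite addrACA -opprD. Qed.
Lemma congM k f f' g g' : cong k f f' -> cong k g g' -> cong k (f * g) (f' * g').
Proof.
move=> h1 h2; apply: (@cong_trans _ (f' * g)).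
  by rewrite /cong -mulrBl; apply: FilMr.
by rewrite /cong -mulrBr; apply: FilMl.
Qed.
Lemma cong_trunc k f : cong k f (tensalg_val (trunc k f)).
Proof. exact: truncP. Qed.
Lemma cong_eq f g : (forall k, cong k f g) -> f = g. Proof. exact: Fil_inj. Qed.

Definition is_homog k (t : tensalg M) := exists x : tpow M k, t = thom x.
Lemma is_homogD k t u : is_homog k t -> is_homog k u -> is_homog k (t + u).
Proof. by case=> x -> [y ->]; exists (x + y); rewrite thomD. Qed.
Lemma is_homog0 k : is_homog k 0. Proof. by exists 0; rewrite thom0. Qed.
Lemma is_homogN k t : is_homog k t -> is_homog k (- t).
Proof. by case=> x ->; exists (- x); apply: val_inj; rewrite /= [RHS]raddfN. Qed.
Lemma is_homogM k l t u : is_homog k t -> is_homog l u -> is_homog (k + l) (t * u).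
Proof.
by case=> x -> [y ->]; exists (tmul x y); apply: val_inj; rewrite /= -homog_mul.
Qed.
Lemma is_homog_val k t l : is_homog k t -> k <> l -> tensalg_val t l = 0.
Proof. by case=> x -> kl; apply: homog_neq. Qed.
End Congruence.

(** * The cyclic Leibniz rule for series *)
Section Homogeneity.
Variables (F : fieldType) (n : nat) (Ei : 'I_n.+1 -> falgType F).
Local Notation E := (prodalg Ei).
Local Notation e := (prod_idem Ei).
Variables (M : fdbimod E E) (M0 : {vspace M}) (D : tensalg M -> TT M).
Hypotheses (freeM : Zfree_generator M0) (HD : is_Delta M0 D).

Lemma is_homog_E s : is_homog 0 (tens_E M s). Proof. by exists s. Qed.
Lemma is_homog_M (m : M) : is_homog 1 (tens_M m). Proof. by exists (tpure m (1 : tpow M 0)). Qed.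
Lemma is_homog_EM s k (t : tensalg M) : is_homog k t -> is_homog k (tens_E M s * t).
Proof. by move=> ht; rewrite -[k]add0n; apply: is_homogM ht; apply: is_homog_E. Qed.
Lemma is_homog_ME s k (t : tensalg M) : is_homog k t -> is_homog k (t * tens_E M s).
Proof. by move=> ht; rewrite -[k]addn0; apply: is_homogM ht _; apply: is_homog_E. Qed.
Lemma is_homog_corner_sum k (t : tensalg M) : is_homog k t -> is_homog k (corner_sum t).
Proof.
move=> ht; rewrite /corner_sum; elim/big_ind: _ => [|x y|i _].
- exact: is_homog0.
- exact: is_homogD.
- by apply: is_homog_ME; apply: is_homog_EM.
Qed.

Lemma cyc_h0_E_is_homog s j t : is_homog j t -> is_homog j (cyc_h0 D (tens_E M s) t).
Proof.
move=> ht; rewrite (cyc_h0_E HD); apply: is_homog_corner_sum; apply: is_homogD.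
  exact: is_homog_EM.
by apply: is_homogN; apply: is_homog_ME.
Qed.

Lemma cyc_h0_M_is_homog (m : M) j t : is_homog j t -> is_homog j.+1 (cyc_h0 D (tens_M m) t).
Proof.
move=> ht; move: m; apply: (Zfree_ind freeM) => [|m m' hm hm'|s m r mM].
- by rewrite tens_M0 (cyc_h0_0l HD); apply: is_homog0.
- by rewrite tens_MD (cyc_h0_Dl HD); apply: is_homogD.
rewrite tens_M_ract tens_M_lact !(cyc_h0M HD).
have hm u : is_homog j u -> is_homog j.+1 (tens_M m * u).
  by move=> hu; rewrite -add1n; apply: is_homogM hu; apply: is_homog_M.
apply: is_homogD; last first.
  apply: cyc_h0_E_is_homog; rewrite -addn1; apply: is_homogM ht _.
  by apply: is_homog_EM; apply: is_homog_M.
apply: is_homogD.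
  by apply: cyc_h0_E_is_homog; apply: hm; apply: is_homog_EM.
rewrite (cyc_h0_M HD) //; apply: is_homog_corner_sum; apply: hm.
by apply: is_homog_ME; apply: is_homog_EM.
Qed.

(** Homogeneity makes [cyc_h], which keeps only one component of each product of
    homogeneous parts, agree with [cyc_h0] on polynomials ([cyc_h_val]). *)
Lemma cyc_h0_is_homog k (x : tpow M k) j t :
  is_homog j t -> is_homog (k + j) (cyc_h0 D (thom x) t).
Proof.
elim: k x j t => [|k IHk] x j t ht; first exact: cyc_h0_E_is_homog.
elim/tensor_ind: x => [|m x y IHy].
  by rewrite thom0 (cyc_h0_0l HD); apply: is_homog0.
rewrite [thom _]thomD (cyc_h0_Dl HD); apply: is_homogD IHy.
rewrite thom_pure (cyc_h0M HD); apply: is_homogD.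
  by apply: cyc_h0_M_is_homog; apply: is_homogM ht; exists x.
rewrite addSnnS; apply: IHk; rewrite -addn1; apply: is_homogM ht _; exact: is_homog_M.
Qed.

Implicit Types (f g x : fts M).
Lemma cyc_h_Dl f f' g : cyc_h D (f + f') g = cyc_h D f g + cyc_h D f' g.
Proof.
apply: ftsP => l; rewrite ftsD /cyc_h -big_split; apply: eq_bigr => i _ /=.
by rewrite ftsD thomD (cyc_h0_Dl HD) tvalD ftsD.
Qed.
Lemma cyc_h_Dr f g g' : cyc_h D f (g + g') = cyc_h D f g + cyc_h D f g'.
Proof.
apply: ftsP => l; rewrite ftsD /cyc_h -big_split; apply: eq_bigr => i _ /=.
by rewrite ftsD thomD cyc_h0_Dr tvalD ftsD.
Qed.
Lemma cyc_h_0l g : cyc_h D 0 g = 0.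
Proof. by apply: (addrI (cyc_h D 0 g)); rewrite -cyc_h_Dl !addr0. Qed.
Lemma cyc_h_0r f : cyc_h D f 0 = 0.
Proof. by apply: (addrI (cyc_h D f 0)); rewrite -cyc_h_Dr !addr0. Qed.
Lemma cyc_h_Bl f f' g : cyc_h D (f - f') g = cyc_h D f g - cyc_h D f' g.
Proof. by apply/eqP; rewrite eq_sym subr_eq -cyc_h_Dl subrK. Qed.
Lemma cyc_h_Br f g g' : cyc_h D f (g - g') = cyc_h D f g - cyc_h D f g'.
Proof. by apply/eqP; rewrite eq_sym subr_eq -cyc_h_Dr subrK. Qed.

Lemma cyc_h_Fil p q f g : Fil p f -> Fil q g -> Fil (p + q) (cyc_h D f g).
Proof.
move=> hf hg l lpq; rewrite /cyc_h big1 // => s _.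
have [sp|ps] := ltnP s p; first by rewrite hf // thom0 (cyc_h0_0l HD).
rewrite hg ?thom0 ?cyc_h0_0r // ltn_subLR; last by rewrite -ltnS.
by apply: leq_trans lpq _; rewrite leq_add2r.
Qed.
Lemma cyc_h_cong k f f' g g' : cong k f f' -> cong k g g' ->
  cong k (cyc_h D f g) (cyc_h D f' g').
Proof.
move=> h1 h2; apply: (@cong_trans _ _ _ _ (cyc_h D f' g)).
  by rewrite /cong -cyc_h_Bl -[k]addn0; apply: cyc_h_Fil.
by rewrite /cong -cyc_h_Br -[k]add0n; apply: cyc_h_Fil.
Qed.

Lemma cyc_h_val (f g : tensalg M) :
  cyc_h D (tensalg_val f) (tensalg_val g) = tensalg_val (cyc_h0 D f g).
Proof.
elim/tensalg_homog_ind: f => [|f f' IHf IHf'|i x].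
- by rewrite (cyc_h0_0l HD) tval0 cyc_h_0l.
- by rewrite tvalD cyc_h_Dl (cyc_h0_Dl HD) tvalD IHf IHf'.
elim/tensalg_homog_ind: g => [|g g' IHg IHg'|j y].
- by rewrite cyc_h0_0r tval0 cyc_h_0r.
- by rewrite tvalD cyc_h_Dr cyc_h0_Dr tvalD IHg IHg'.
apply: ftsP => l; rewrite /cyc_h /=.
have hd : is_homog (i + j) (cyc_h0 D (thom x) (thom y)).
  by apply: cyc_h0_is_homog; exists y.
have [el|nl] := eqVneq (i + j)%N l; last first.
  rewrite (is_homog_val hd); last exact/eqP.
  rewrite big1 // => s _; have [es|ns] := eqVneq i (s : nat); last first.
    by rewrite homog_neq ?thom0 ?(cyc_h0_0l HD) //; apply/eqP.
  rewrite [homog y _]homog_neq ?thom0 ?cyc_h0_0r // => ej.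
  by move/eqP: nl; apply; rewrite ej es subnKC // -ltnS.
have il : (i < l.+1)%N by rewrite ltnS -el leq_addr.
rewrite (bigD1 (Ordinal il)) //= big1 => [|s /eqP ns].
  rewrite addr0 homog_id; have -> : (l - i)%N = j by rewrite -el addKn.
  by rewrite homog_id.
rewrite homog_neq ?thom0 ?(cyc_h0_0l HD) // => es.
by apply: ns; apply: val_inj.
Qed.

Lemma cyc_h_cong_val k f g (f0 g0 : tensalg M) :
  cong k f (tensalg_val f0) -> cong k g (tensalg_val g0) ->
  cong k (cyc_h D f g) (tensalg_val (cyc_h0 D f0 g0)).
Proof.
move=> hf hg; have := cyc_h_cong hf hg.
by rewrite (cyc_h_val f0 g0).
Qed.

(** Both sides depend, modulo series of order [k], only on truncations of the
    arguments, where the rule is [cyc_h0M]. *)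
Lemma cyc_hM f g x : cyc_h D (f * g) x = cyc_h D f (g * x) + cyc_h D g (x * f).
Proof.
apply: cong_eq => k.
have hM (u v : fts M) (u0 v0 : tensalg M) : cong k u (tensalg_val u0) -> cong k v (tensalg_val v0) ->
    cong k (u * v) (tensalg_val (u0 * v0)).
  by move=> hu hv; have := congM hu hv; rewrite -tvalM.
have [f0 hf] : exists f0 : tensalg M, cong k f (tensalg_val f0).
  by exists (trunc k f); apply: cong_trunc.
have [g0 hg] : exists g0 : tensalg M, cong k g (tensalg_val g0).
  by exists (trunc k g); apply: cong_trunc.
have [x0 hx] : exists x0 : tensalg M, cong k x (tensalg_val x0).
  by exists (trunc k x); apply: cong_trunc.
apply: cong_trans (cyc_h_cong_val (hM _ _ _ _ hf hg) hx) _.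
rewrite (cyc_h0M HD) tvalD; apply: cong_sym.
by apply: congD; apply: cyc_h_cong_val => //; apply: hM.
Qed.

End Homogeneity.

(** * Stripping the first letter *)
Section PsiExt.
Variables (F : fieldType) (n : nat) (Ei : 'I_n.+1 -> falgType F).
Local Notation E := (prodalg Ei).
Variables (M : fdbimod E E) (psi : M -> E).
Hypothesis rpsi : right_linear psi.
Implicit Types f g : fts M.

Lemma psi_extD f g : psi_ext psi (f + g) = psi_ext psi f + psi_ext psi g.
Proof.
apply: ftsP => l; rewrite ftsD /psi_ext.
have := tlift_linear (psi_ext_balanced l rpsi) 1 (f l.+1) (g l.+1).
by rewrite !scale1r.
Qed.
Lemma psi_ext_M (m : M) f : psi_ext psi (fts_M m * f) = fts_E M (psi m) * f.
Proof.
apply: ftsP => l; rewrite fts_E_mulE /psi_ext fts_M_mulS.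
exact: (tlift_pure m (f l) (psi_ext_balanced l rpsi)).
Qed.
Lemma psi_ext_tlift0 l :
  @tlift F E E E M (tpow M l) (tpow M l) (fun m x => lact (psi m) x) 0 = 0.
Proof.
have h := scalable_linear (tlift_linear (psi_ext_balanced l rpsi)) 0 0.
apply: etrans (etrans _ h) _; last exact: scale0r.
by congr tlift; rewrite /= scale0r.
Qed.
Lemma psi_ext_Fil k f : Fil k.+1 f -> Fil k (psi_ext psi f).
Proof. by move=> hf l lk; rewrite /psi_ext hf // psi_ext_tlift0. Qed.
Lemma psi_ext_E s : psi_ext psi (fts_E M s) = 0.
Proof.
by apply: ftsP => l; rewrite /psi_ext /fts_E homog_neq // psi_ext_tlift0.
Qed.
End PsiExt.

(** * Cyclic derivations *)
Section CyclicDerivations.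
Variables (F : fieldType) (n : nat) (Ei : 'I_n.+1 -> falgType F).
Local Notation E := (prodalg Ei).
Variables (M : fdbimod E E).

(** The last clause abstracts the form [x |-> sum q x p] of the operations met in
    practice; unlike that form it is visibly invariant under homeomorphic
    isomorphisms, and it is all that [cder_Rideal] requires. *)
Record cyclic_derivation (c : fts M -> fts M -> fts M) : Prop := CyclicDerivation {
  cder_Dl : forall f g x, c (f + g) x = c f x + c g x;
  cder_Dr : forall f x y, c f (x + y) = c f x + c f y;
  cder_M : forall f g x, c (f * g) x = c f (g * x) + c g (x * f);
  cder_E : forall s x, c (fts_E M s) x = 0;
  cder_Fil : forall k f x, Fil k.+1 f -> Fil k (c f x);
  cder_ideal : forall I f x, closed_ideal I -> I x -> I (c f x)
}.
End CyclicDerivations.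

(** * Partial derivatives along the basis *)
Section Partial.
Variables (F : fieldType) (n : nat) (Ei : 'I_n.+1 -> falgType F).
Local Notation E := (prodalg Ei).
Local Notation e := (prod_idem Ei).
Variables (M : fdbimod E E) (M0 : {vspace M}) (D : tensalg M -> TT M).
Hypotheses (freeM : Zfree_generator M0) (HD : is_Delta M0 D).
Variables (L : 'I_n.+1 -> seq E) (B : 'I_n.+1 -> 'I_n.+1 -> seq M).
Hypothesis HL : forall i, basis_of (<[e i]> * fullv)%VS (L i).
Hypothesis HB : forall i j, basis_of (peirce M0 i j) (B i j).
Variable star : M -> E -> M -> E.
Hypothesis Hstar : is_dual L B star.

Lemma basis_peirce i j b : b \in B i j -> b \in peirce M0 i j.
Proof. exact: (basis_mem (HB i j)). Qed.
Lemma basis_lid i j b : b \in B i j -> lact (e i) b = b.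
Proof. by move/basis_peirce/peirce_id => []. Qed.
Lemma basis_rid i j b : b \in B i j -> ract b (e j) = b.
Proof. by move/basis_peirce/peirce_id => []. Qed.
Lemma basis_neq0 i j b : b \in B i j -> b != 0.
Proof.
exact: (free_not0 (basis_free (HB i j))).
Qed.
Lemma basis_in_M0 i j b : b \in B i j -> b \in M0.
Proof.
move=> /basis_peirce/peirceP[m0 h ->]; have [st _] := freeM.
have ez k : e k \in @Zmem F n Ei.
  rewrite /Zmem -topredE /=; apply: (subvP _ _ (memv_line (e k))).
  exact: (sumv_sup k).
have [h1 _] := st (InZ (ez i)) _ h.
by have [_ h2] := st (InZ (ez j)) _ h1.
Qed.
(** A common element [b] satisfies [b = e_i e_i' b] and [b = b e_j' e_j], which
    vanish for distinct indices. *)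
Lemma basis_inj i j i' j' b : b \in B i j -> b \in B i' j' -> i = i' /\ j = j'.
Proof.
move=> h1 h2; have b0 := basis_neq0 h1; split; apply/eqP/negPn/negP => ne.
  move/eqP: b0; apply; rewrite -(basis_lid h1) -(basis_lid h2) lactA prod_idemM.
  rewrite (negPf ne); apply: (addrI (lact (0 : E) b)).
  by rewrite -lactDl !addr0.
move/eqP: b0; apply; rewrite -(basis_rid h2) -[X in ract X _](basis_rid h1).
rewrite ractA prod_idemM (negPf ne); apply: (addrI (ract b (0 : E))).
by rewrite -ractDr !addr0.
Qed.

(** The functional applied to [cyc_delta P] to obtain [X_{a^*}(P)]. *)
Definition contract i (a : M) (f : fts M) : fts M :=
  \sum_(s <- L i) psi_ext (star a s) f * fts_E M s.
Definition cyc_partial i a (f x : fts M) : fts M := contract i a (cyc_h D f x).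

Lemma XeltE i a P : Xelt D L star i a P = cyc_partial i a P 1.
Proof. by []. Qed.

Section OneBasisElement.
Variables (i j : 'I_n.+1) (a : M).
Hypothesis Ba : a \in B i j.
Implicit Types (f g x y z : fts M) (r s t : E).

Lemma star_right s : s \in L i -> right_linear (star a s).
Proof. by move=> Ls; case: (Hstar Ba Ls). Qed.

Lemma contractD f g : contract i a (f + g) = contract i a f + contract i a g.
Proof.
rewrite /contract -big_split; apply: eq_big_seq => s Ls /=.
by rewrite (psi_extD (star_right Ls)) mulrDl.
Qed.
Lemma contract0 : contract i a 0 = 0.
Proof. by apply: (addrI (contract i a 0)); rewrite -contractD !addr0. Qed.
Lemma contractB f g : contract i a (f - g) = contract i a f - contract i a g.
Proof. by apply/eqP; rewrite eq_sym subr_eq -contractD subrK. Qed.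
Lemma contract_sum (I : Type) (r : seq I) (P : pred I) (f : I -> fts M) :
  contract i a (\sum_(k <- r | P k) f k) = \sum_(k <- r | P k) contract i a (f k).
Proof. exact: (big_morph _ contractD contract0). Qed.
Lemma contract_Fil k f : Fil k.+1 f -> Fil k (contract i a f).
Proof.
move=> hf; rewrite /contract big_seq; apply: Fil_sum => s Ls; apply: FilMr.
exact: (psi_ext_Fil (star_right Ls) hf).
Qed.
Lemma contract_M m y : contract i a (fts_M m * y) =
  \sum_(s <- L i) fts_E M (star a s m) * y * fts_E M s.
Proof. by apply: eq_big_seq => s Ls; rewrite (psi_ext_M (star_right Ls)). Qed.
Lemma contract_E s : contract i a (fts_E M s) = 0.
Proof.
rewrite /contract big_seq big1 // => l Ll.
by rewrite (psi_ext_E (star_right Ll)) mul0r.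
Qed.

(** For [r] in the basis [L i'] this is the definition of the dual maps; it
    extends to [e_i' E] because both sides are linear in [r]. *)
Lemma contract_lact i' j' b r y : b \in B i' j' -> r \in (<[e i']> * fullv)%VS ->
  contract i a (fts_M (lact r b) * y) =
    if a == b then fts_E M (e j) * y * fts_E M r else 0.
Proof.
move=> Bb; rewrite -(span_basis (HL i')) => /(coord_span (X := in_tuple (L i'))) ->.
set c := coord _; move: (c) => {}c.
have l0 m : lact (0 : E) m = 0 :> M.
  by apply: (addrI (lact 0 m)); rewrite -lactDl !addr0.
elim/big_ind: _ => [|r1 r2 h1 h2|k _].
- by rewrite l0 fts_M0 mul0r contract0 fts_E0 mulr0; case: eqP.
- rewrite lactDl fts_MD mulrDl contractD h1 h2 fts_ED mulrDr.
  by case: eqP; rewrite ?addr0.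
have : (L i')`_k \in L i' by apply: mem_nth.
move: (_`_k) => l Ll; move: (c k _) => d {c l0 k}.
have -> : lact (d *: l) b = ract (lact l b) d%:A.
  rewrite lactZl -[lact l b in LHS]ract1; apply/esym.
  exact: (scalable_linear (bon_rr (bimod_str M) (lact l b)) d 1).
rewrite fts_M_ract fts_EZ fts_E1 -mulrA -scalerAl mul1r contract_M.
have [eab|nab] := eqVneq a b; last first.
  rewrite big_seq big1 // => s Ls; have [_ _ h0] := Hstar Ba Ls.
  rewrite (h0 _ _ _ _ Bb Ll) ?fts_E0 ?mul0r //.
  by move=> /(congr1 fst) /= ab; rewrite ab eqxx in nab.
move: Bb Ll; rewrite -eab => Bb; have [<- _] := basis_inj Ba Bb => Ll.
rewrite (bigD1_seq l) //=; last exact: (free_uniq (basis_free (HL i))).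
have [_ -> _] := Hstar Ba Ll.
rewrite big_seq_cond big1 ?addr0 => [|s /andP[Ls ns]]; last first.
  have [_ _ h0] := Hstar Ba Ls.
  rewrite (h0 _ _ _ _ Ba Ll) ?fts_E0 ?mul0r //.
  by move=> /(congr1 snd) /= ls; rewrite ls eqxx in ns.
by rewrite fts_EZ -!scalerAr -scalerAl.
Qed.

Lemma contract_sbt i' j' b s t y : b \in B i' j' ->
  contract i a (fts_M (ract (lact s b) t) * y) =
    if a == b then fts_E M (e j) * (fts_E M t * y) * fts_E M (s * e i') else 0.
Proof.
move=> Bb; rewrite fts_M_ract -mulrA -{1}(basis_lid Bb) lactA.
apply: (contract_lact _ Bb); rewrite idem_central.
by apply: memv_mul; [apply: memv_line|apply: memvf].
Qed.

(** On words [s b t y] both sides are [e_j t y r s e_i] when [b = a]: left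
    multiplication by [r] acts on the letter [s] that [contract] returns at the
    right end. *)
Lemma contract_trace r z : contract i a (fts_E M r * z) = contract i a (z * fts_E M r).
Proof.
have [g ->] := fts_decomp z.
rewrite mulrDr mulrDl !contractD !fts_EM !contract_E !add0r mulr_sumr mulr_suml !contract_sum.
apply: eq_bigr => k _; move: (_`_k) (g k) => m y.
move: m; apply: (Zfree_basis_ind freeM HB) => [|m m' h h'|i' j' s b t Bb].
- by rewrite fts_M0 !mul0r mulr0.
- by rewrite fts_MD !mulrDl mulrDr !contractD h h'.
rewrite mulrA -[in LHS]fts_M_lact -[in LHS]lractA lactA -mulrA !(contract_sbt _ _ _ Bb).
by case: eqP => // _; rewrite -!mulrA fts_EM !mulrA.
Qed.

(** Each [e_k] on the left moves to the right, and the [e_k] sum to one. *)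
Lemma contract_corner_sum (x : tensalg M) :
  contract i a (tensalg_val (corner_sum x)) = contract i a (tensalg_val x).
Proof.
rewrite /corner_sum tval_sum contract_sum.
transitivity (\sum_(k < n.+1) contract i a (tensalg_val x * fts_E M (e k))).
  apply: eq_bigr => k _; rewrite !tvalM (_ : tensalg_val (tens_E M (e k)) = fts_E M (e k)) //.
  by rewrite -mulrA contract_trace -mulrA fts_EM idem_id.
rewrite -contract_sum -mulr_sumr.
have eD : {morph fts_E M : x y / x + y} by move=> u v; apply: fts_ED.
by rewrite -(big_morph _ eD (fts_E0 M)) prod_idem_sum mulr1.
Qed.

Lemma cyc_partial_Dl f g x : cyc_partial i a (f + g) x = cyc_partial i a f x + cyc_partial i a g x.
Proof. by rewrite /cyc_partial (cyc_h_Dl HD) contractD. Qed.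
Lemma cyc_partial_Dr f x y : cyc_partial i a f (x + y) = cyc_partial i a f x + cyc_partial i a f y.
Proof. by rewrite /cyc_partial cyc_h_Dr contractD. Qed.
Lemma cyc_partial_M f g x :
  cyc_partial i a (f * g) x = cyc_partial i a f (g * x) + cyc_partial i a g (x * f).
Proof. by rewrite /cyc_partial (cyc_hM freeM HD) contractD. Qed.
Lemma cyc_partial_Fil k f x : Fil k.+1 f -> Fil k (cyc_partial i a f x).
Proof.
move=> hf; apply: contract_Fil; rewrite -[k.+1]addn0; exact: (cyc_h_Fil HD).
Qed.
Lemma contract_cong k f g : cong k.+1 f g -> cong k (contract i a f) (contract i a g).
Proof. by rewrite /cong -contractB; apply: contract_Fil. Qed.

(** The commutator [s x - x s] is killed by [contract_trace]. *)
Lemma cyc_partial_E s x : cyc_partial i a (fts_E M s) x = 0.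
Proof.
apply: cong_eq => k.
have hx := cong_trunc (k := k.+1) x.
have h := cyc_h_cong_val freeM HD (cong_refl (k := k.+1) (fts_E M s) :
  cong _ _ (tensalg_val (tens_E M s))) hx.
apply: cong_trans (contract_cong h) _; rewrite (cyc_h0_E HD) contract_corner_sum tvalB !tvalM.
by rewrite contractB contract_trace subrr; apply: cong_refl.
Qed.

Lemma cyc_partial_basis i' j' b x : b \in B i' j' ->
  cyc_partial i a (fts_M b) x =
    if a == b then fts_E M (e j') * x * fts_E M (e i') else 0.
Proof.
move=> Bb; transitivity (contract i a (fts_M b * x)).
  apply: cong_eq => k.
  have hx := cong_trunc (k := k.+1) x.
  have h := cyc_h_cong_val freeM HD (cong_refl (k := k.+1) (fts_M b) :
    cong _ _ (tensalg_val (tens_M b))) hx.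
  apply: cong_trans (contract_cong h) _.
  rewrite (cyc_h0_M HD) ?(basis_in_M0 Bb) // contract_corner_sum tvalM.
  by apply: contract_cong; apply: cong_sym; apply: congM => //; apply: cong_refl.
rewrite -[b in LHS](basis_lid Bb) -[lact _ _]ract1 (contract_sbt _ _ _ Bb) idem_id.
case: eqP => // eab; rewrite fts_E1 mul1r.
by have [_ <-] := basis_inj Ba (etrans (congr1 (fun u => u \in B i' j') eab) Bb).
Qed.
End OneBasisElement.
End Partial.

(** * The ideal of a potential and cyclic derivations *)
Section Expansion.
Variables (F : fieldType) (n : nat) (Ei : 'I_n.+1 -> falgType F).
Local Notation E := (prodalg Ei).
Local Notation e := (prod_idem Ei).
Variables (M : fdbimod E E) (M0 : {vspace M}) (D : tensalg M -> TT M).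
Hypotheses (freeM : Zfree_generator M0) (HD : is_Delta M0 D).
Variables (L : 'I_n.+1 -> seq E) (B : 'I_n.+1 -> 'I_n.+1 -> seq M).
Hypothesis HL : forall i, basis_of (<[e i]> * fullv)%VS (L i).
Hypothesis HB : forall i j, basis_of (peirce M0 i j) (B i j).
Variable star : M -> E -> M -> E.
Hypothesis Hstar : is_dual L B star.
Local Notation cyc_partial := (cyc_partial D L star).

Lemma tensalg_gen_ind (Q : tensalg M -> Prop) :
  Q 0 -> (forall t u, Q t -> Q u -> Q (t + u)) ->
  (forall t u, Q t -> Q u -> Q (t * u)) ->
  (forall s, Q (tens_E M s)) ->
  (forall i j b, b \in B i j -> Q (tens_M b)) -> forall t, Q t.
Proof.
move=> Q0 QD QM QE QB; apply: tensalg_homog_ind => // k.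
elim: k => [|k IHk] x; first exact: QE.
elim/tensor_ind: x => [|m x y IHy]; first by rewrite thom0.
rewrite [thom _]thomD; apply: (QD) IHy; rewrite thom_pure; apply: (QM) => //.
move: m; apply: (Zfree_basis_ind freeM HB) => [|m m' h h'|i j s b t Bb].
- by rewrite tens_M0.
- by rewrite tens_MD; apply: QD.
- rewrite tens_M_ract tens_M_lact; apply: (QM) => //; apply: QM => //.
  exact: QB Bb.
Qed.

Section Derivation.
Variable c : fts M -> fts M -> fts M.
Hypothesis hc : cyclic_derivation c.
Implicit Types f g x y : fts M.
Lemma cder_0l x : c 0 x = 0.
Proof. by apply: (addrI (c 0 x)); rewrite -(cder_Dl hc) !addr0. Qed.
Lemma cder_0r f : c f 0 = 0.
Proof. by apply: (addrI (c f 0)); rewrite -(cder_Dr hc) !addr0. Qed.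
Lemma cder_Bl f g x : c (f - g) x = c f x - c g x.
Proof. by apply/eqP; rewrite eq_sym subr_eq -(cder_Dl hc) subrK. Qed.
Lemma cder_cong k f g x : cong k.+1 f g -> cong k (c f x) (c g x).
Proof. by rewrite /cong -cder_Bl; apply: (cder_Fil hc). Qed.
Lemma cder_lact (m : M) s x :
  c (fts_M (lact s m)) x = c (fts_M m) (x * fts_E M s).
Proof. by rewrite fts_M_lact (cder_M hc) (cder_E hc) add0r. Qed.
Lemma cder_ract (m : M) s x :
  c (fts_M (ract m s)) x = c (fts_M m) (fts_E M s * x).
Proof. by rewrite fts_M_ract (cder_M hc) (cder_E hc) addr0. Qed.
End Derivation.

(** By the Leibniz rule a cyclic derivation is determined on polynomials by its
    values on generators, and by continuity on all series. *)
Lemma cder_eq c d :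
  cyclic_derivation c -> cyclic_derivation d ->
  (forall i j b x, b \in B i j -> c (fts_M b) x = d (fts_M b) x) ->
  forall f x, c f x = d f x.
Proof.
move=> hc hd cd f x; apply: cong_eq => k.
have hf := cong_trunc (k := k.+1) f.
apply: cong_trans (cder_cong hc x hf) _.
apply: cong_trans _ (cong_sym (cder_cong hd x hf)).
move: (trunc _ _) x => t x {hf f}.
suff -> : c (tensalg_val t) x = d (tensalg_val t) x by apply: cong_refl.
move: t x; apply: tensalg_gen_ind => [x|t u ht hu x|t u ht hu x|s x|i j b Bb x].
- by rewrite tval0 !cder_0l.
- by rewrite tvalD (cder_Dl hc) (cder_Dl hd) ht hu.
- by rewrite tvalM (cder_M hc) (cder_M hd) ht hu.
- exact: etrans (cder_E hc s x) (esym (cder_E hd s x)).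
- exact: cd Bb.
Qed.

(** Closed ideals are preserved since, on polynomials, [cyc_partial i a f x] is a
    finite sum of terms [q x p], and polynomials are dense. *)
Lemma cyc_partial_cder i j a : a \in B i j -> cyclic_derivation (cyc_partial i a).
Proof.
move=> Ba; split.
- exact: (cyc_partial_Dl HD Hstar Ba).
- exact: (cyc_partial_Dr D Hstar Ba).
- exact: (cyc_partial_M freeM HD Hstar Ba).
- exact: (cyc_partial_E freeM HD HL HB Hstar Ba).
- exact: (cyc_partial_Fil HD Hstar Ba).
move=> I f x cI Ix; have [[I0 ID IM] Icl] := cI; apply: Icl => k.
exists (cyc_partial i a (tensalg_val (trunc k.+1 f)) x); last first.
  have := cyc_partial_Fil HD Hstar Ba x (cong_trunc (k := k.+1) f).
  suff -> : cyc_partial i a (f - tensalg_val (trunc k.+1 f)) x =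
    cyc_partial i a f x - cyc_partial i a (tensalg_val (trunc k.+1 f)) x by [].
  by apply/eqP; rewrite eq_sym subr_eq -(cyc_partial_Dl HD Hstar Ba) subrK.
move: (trunc _ _) x Ix => t {f}.
move: t; apply: tensalg_gen_ind => [x Ix|t u ht hu x Ix|t u ht hu x Ix|s x Ix|i' j' b Bb x Ix].
- suff -> : cyc_partial i a (tensalg_val 0) x = 0 by [].
  apply: (addrI (cyc_partial i a 0 x)).
  by rewrite -(cyc_partial_Dl HD Hstar Ba) !addr0.
- by rewrite tvalD (cyc_partial_Dl HD Hstar Ba); apply: ID; [apply: ht|apply: hu].
- rewrite tvalM (cyc_partial_M freeM HD Hstar Ba); apply: ID.
    by apply: ht; case: (IM x (tensalg_val u) Ix).
  by apply: hu; case: (IM x (tensalg_val t) Ix).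
- by rewrite (cyc_partial_E freeM HD HL HB Hstar Ba).
- rewrite (cyc_partial_basis freeM HD HL HB Hstar Ba _ Bb); case: eqP => // _.
  have [h _] := IM x (fts_E M (e j')) Ix.
  by case: (IM _ (fts_E M (e i')) h).
Qed.

(** The chain rule.  The right-hand side is itself a cyclic derivation in
    [f], and at a basis element [b] of [e_i M0 e_j] only the term [a = b]
    remains, [c b (e_j x e_i) = c (e_i b e_j) x]. *)
Lemma cder_expand c : cyclic_derivation c -> forall f x,
  c f x = \sum_i \sum_j \sum_(a <- B i j) c (fts_M a) (cyc_partial i a f x).
Proof.
move=> hc; apply: (cder_eq hc) => [|i j b x Bb].
  pose pc := cyc_partial_cder; split=> [f g x|f x y|f g x|s x|k f x hf|I f x cI Ix].
  - rewrite -big_split; apply: eq_bigr => i _; rewrite -big_split.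
    apply: eq_bigr => j _; rewrite -big_split; apply: eq_big_seq => a Ba /=.
    by rewrite (cder_Dl (pc _ _ _ Ba)) (cder_Dr hc).
  - rewrite -big_split; apply: eq_bigr => i _; rewrite -big_split.
    apply: eq_bigr => j _; rewrite -big_split; apply: eq_big_seq => a Ba /=.
    by rewrite (cder_Dr (pc _ _ _ Ba)) (cder_Dr hc).
  - rewrite -big_split; apply: eq_bigr => i _; rewrite -big_split.
    apply: eq_bigr => j _; rewrite -big_split; apply: eq_big_seq => a Ba /=.
    by rewrite (cder_M (pc _ _ _ Ba)) (cder_Dr hc).
  - apply: big1 => i _; apply: big1 => j _; rewrite big_seq big1 // => a Ba.
    by rewrite (cder_E (pc _ _ _ Ba)) (cder_0r hc).
  - apply: Fil_sum => i _; apply: Fil_sum => j _; rewrite big_seq.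
    apply: Fil_sum => a Ba; apply: (@cder_ideal _ _ _ _ _ hc (Fil k)).
      exact: Fil_closed_ideal.
    exact: (cder_Fil (pc _ _ _ Ba)).
  - apply: (closed_ideal_sum _ cI) => i _; apply: (closed_ideal_sum _ cI) => j _.
    rewrite big_seq; apply: (closed_ideal_sum _ cI) => a Ba.
    by apply: (cder_ideal hc) => //; apply: (cder_ideal (pc _ _ _ Ba)).
have pb i' j' a : a \in B i' j' -> c (fts_M a) (cyc_partial i' a (fts_M b) x) =
    if a == b then c (fts_M b) x else 0.
  move=> Ba; rewrite (cyc_partial_basis freeM HD HL HB Hstar Ba _ Bb).
  case: eqP => [->|_]; last exact: cder_0r.
  rewrite -(cder_lact hc) (basis_lid HB Bb) -(cder_ract hc).
  by rewrite (basis_rid HB Bb).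
rewrite (bigD1 i) //= (bigD1 j) //= (bigD1_seq b) //=; last first.
  exact: (free_uniq (basis_free (HB i j))).
rewrite (pb _ _ _ Bb) eqxx [X in _ + X + _ + _]big_seq_cond [X in _ + X + _ + _]big1; last first.
  by move=> a /andP[Ba nab]; rewrite (pb _ _ _ Ba) (negPf nab).
rewrite [X in _ + X + _]big1 ?addr0; last first.
  move=> j' /negP nj; rewrite big_seq big1 // => a Ba; rewrite (pb _ _ _ Ba).
  case: eqP => // eab; case: nj; rewrite -eab in Bb.
  by have [_ ->] := basis_inj HB Ba Bb.
rewrite big1 ?addr0 // => i' /negP ni; apply: big1 => j' _.
rewrite big_seq big1 // => a Ba; rewrite (pb _ _ _ Ba).
case: eqP => // eab; case: ni; rewrite -eab in Bb.
by have [-> _] := basis_inj HB Ba Bb.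
Qed.

Lemma Rideal_closed P : closed_ideal (Rideal D L B star P).
Proof. apply: closure_closed_ideal; exact: smallest_two_sided. Qed.

(** In the chain rule the arguments [cyc_partial i a P 1] are the generators of
    the ideal, and each [c a] preserves it. *)
Lemma cder_Rideal c P : cyclic_derivation c -> Rideal D L B star P (c P 1).
Proof.
move=> hc; rewrite (cder_expand hc); have hR := Rideal_closed P.
apply: (closed_ideal_sum _ hR) => i _; apply: (closed_ideal_sum _ hR) => j _.
rewrite big_seq; apply: (closed_ideal_sum _ hR) => a Ba.
apply: (cder_ideal hc _ hR); apply: closure_sub => I [_ hI]; apply: hI.
by exists i, j, a.
Qed.

Lemma Rideal_sub P (I : set (fts M)) : closed_ideal I ->
  (forall c, cyclic_derivation c -> I (c P 1)) -> Rideal D L B star P `<=` I.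
Proof.
move=> cI hI; apply: sub_closure_ideal => // _ [i [j [a [Ba ->]]]].
by rewrite XeltE; apply: hI; apply: cyc_partial_cder Ba.
Qed.

End Expansion.

(** * Isomorphisms over the base algebra *)

(** If [K + V = A] and [1 = k + v], then [k v] lies in [K] and in [V], so that
    [k] is idempotent; when this forces [k = 0], the complement [V] contains
    [1] and [K] vanishes. *)
Lemma semisimple_ideal_idem (F : fieldType) (A : falgType F) (K : {vspace A}) : semisimple A ->
  left_ideal K -> (forall k, k \in K -> k * k = k -> k = 0) ->
  forall k, k \in K -> k = 0.
Proof.
move=> ssA lK idK u uK; have [V [lV KV KV0]] := ssA K lK.
have /memv_addP[k kK [v vV k1]] : (1 : A) \in (K + V)%VS by rewrite KV memvf.
have kv0 : k * v = 0.
  apply/eqP; rewrite -memv0 -KV0 memv_cap lV // andbT.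
  have -> : k * v = k - k * k.
    by apply/eqP; rewrite eq_sym subr_eq -mulrDr addrC -k1 mulr1.
  by rewrite rpredB // lK.
have k0 : k = 0.
  by apply: idK => //; rewrite -[in RHS](mulr1 k) k1 mulrDr kv0 addr0.
have uV : u \in V by rewrite -[u]mulr1 lV // k1 k0 add0r.
by apply/eqP; rewrite -memv0 -KV0 memv_cap uK.
Qed.

Section Isomorphisms.
Variables (F : fieldType) (n : nat) (Ei : 'I_n.+1 -> falgType F).
Local Notation E := (prodalg Ei).
Local Notation e := (prod_idem Ei).
Hypothesis ssE : forall i, semisimple (Ei i).

Record ring_map_over_E (M M' : fdbimod E E) (phi : fts M -> fts M') : Prop :=
  RingMapOverE {
    over_E_D : forall f g, phi (f + g) = phi f + phi g;
    over_E_M : forall f g, phi (f * g) = phi f * phi g;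
    over_E_E : forall s : E, phi (fts_E M s) = fts_E M' s
  }.

Section OneWay.
Variables (M M' : fdbimod E E) (phi : fts M -> fts M').
Hypothesis hphi : ring_map_over_E phi.
Let phiD := over_E_D hphi.
Let phiM := over_E_M hphi.
Let phi_E := over_E_E hphi.

Lemma over_E_0 : phi 0 = 0.
Proof. by apply: (addrI (phi 0)); rewrite -phiD !addr0. Qed.
Lemma over_E_B f g : phi (f - g) = phi f - phi g.
Proof. by apply/eqP; rewrite eq_sym subr_eq -phiD subrK. Qed.
Lemma over_E_1 : phi 1 = 1.
Proof. exact: phi_E. Qed.
Lemma over_E_sum (I : Type) (r : seq I) (P : pred I) (f : I -> fts M) :
  phi (\sum_(k <- r | P k) f k) = \sum_(k <- r | P k) phi (f k).
Proof. exact: (big_morph _ phiD over_E_0). Qed.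

Definition const_part (m : M) : E := phi (fts_M m) 0%N.

Lemma const_part_lact s m : const_part (lact s m) = s * const_part m.
Proof. by rewrite /const_part fts_M_lact phiM phi_E fts_mul_0 fts_E_id. Qed.
Lemma const_partD m m' : const_part (m + m') = const_part m + const_part m'.
Proof. by rewrite /const_part fts_MD phiD ftsD. Qed.
Lemma const_part_linear i : linear (fun m : M => prod_proj (const_part m) i : Ei i).
Proof.
move=> c m m'; rewrite const_partD proj_add; congr (_ + _).
have -> : c *: m = lact c%:A m by rewrite lactZl lact1.
by rewrite const_part_lact proj_mul proj_scale proj_one -scalerAl mul1r.
Qed.

(** The [i]-th components of the constant terms form a left ideal of [Ei i].  If
    [k], the component of [const_part w], is idempotent, applying [phi] to a right
    inverse of [1 - w] shows that [1 - k] is right invertible, and [k (1 - k) = 0]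
    gives [k = 0]. *)
Lemma const_part0 m : const_part m = 0.
Proof.
apply/prodP => i; rewrite proj_zero.
pose f : {linear M -> Ei i} := HB.pack (fun m : M => prod_proj (const_part m) i : Ei i)
  (GRing.isLinear.Build F M (Ei i) *:%R _ (const_part_linear i)).
have fE u : linfun f u = prod_proj (const_part u) i by rewrite lfunE.
have idealK : left_ideal (limg (linfun f)).
  move=> a u /memv_imgP[w _ ->]; rewrite fE.
  (* The lift of [a] to the product that is zero in the other components. *)
  have -> : a * prod_proj (const_part w) i =
      linfun f (lact (mkprod (dfwith (fun j => 0 : Ei j) a)) w).
    by rewrite fE const_part_lact proj_mul mkprodE dfwith_in.
  exact/memv_img/memvf.
have idem0 k : k \in limg (linfun f) -> k * k = k -> k = 0.
  move=> /memv_imgP[w _ ->]; rewrite fE => kk.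
  have [y hy] := Fil_geometric (fts_M_Fil w).
  have := congr1 (fun g => prod_proj ((phi g) 0%N : E) i) hy => /=.
  rewrite phiM over_E_B over_E_1 fts_mul_0 ftsD ftsN -fts_E1 fts_E_id.
  rewrite -/(const_part w).
  set z := prod_proj (const_part w) i in kk *.
  have -> : prod_proj ((1 - const_part w) * (phi y 0%N : E)) i
      = (1 - z) * prod_proj (phi y 0%N : E) i.
    by rewrite proj_mul proj_add proj_one; congr ((_ + _) * _); apply: mkprodE.
  rewrite proj_one => /(congr1 (fun x => z * x)).
  by rewrite mulr1 mulrA mulrBr mulr1 kk subrr mul0r.
have mK : linfun f m \in limg (linfun f) by apply/memv_img/memvf.
by have := semisimple_ideal_idem (@ssE i) idealK idem0 mK; rewrite fE.
Qed.

Lemma over_E_Fil k f : Fil k f -> Fil k (phi f).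
Proof.
elim: k f => [|k IHk] f // /fts_decomp_Fil[g -> hg].
rewrite over_E_sum; apply: Fil_sum => i _; rewrite phiM -add1n.
apply: FilM; last exact: IHk.
by case=> // _; apply: const_part0.
Qed.

Lemma closed_ideal_preim (I : set (fts M')) :
  closed_ideal I -> closed_ideal [set f | I (phi f)].
Proof.
case=> -[I0 ID IM] Icl; split=> [|f h].
  split=> /= [|f g hf hg|f g hf]; first by rewrite over_E_0.
    by rewrite phiD; apply: ID.
  by rewrite !phiM; apply: IM.
apply: Icl => k; have [g Ig hg] := h k; exists (phi g) => //.
by rewrite -over_E_B; apply: over_E_Fil.
Qed.
End OneWay.

Section TwoWays.
Variables (M M' : fdbimod E E) (phi : fts M -> fts M') (psi : fts M' -> fts M).
Hypotheses (hphi : ring_map_over_E phi) (hpsi : ring_map_over_E psi).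
Hypothesis phiK : cancel phi psi.

(** A closed ideal [I] of the source corresponds to the closed ideal of all [g]
    with [psi g] in [I]. *)
Lemma cder_transport c : cyclic_derivation c ->
  cyclic_derivation (fun f x : fts M => psi (c (phi f) (phi x))).
Proof.
have [phiD phiM phi_E] := hphi; have [psiD psiM psi_E] := hpsi.
move=> hc; split=> [f g x|f x y|f g x|s x|k f x hf|I f x cI Ix].
- by rewrite phiD (cder_Dl hc) psiD.
- by rewrite phiD (cder_Dr hc) psiD.
- by rewrite phiM (cder_M hc) psiD !phiM.
- by rewrite phi_E (cder_E hc) (over_E_0 hpsi).
- by apply: (over_E_Fil hpsi); apply: (cder_Fil hc); apply: (over_E_Fil hphi).
apply: (cder_ideal hc _ (closed_ideal_preim hpsi cI)).
by rewrite /= phiK.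
Qed.
End TwoWays.
End Isomorphisms.

Theorem theorem4p7 (F : fieldType) (n : nat) (Ei : 'I_n.+1 -> falgType F)
  (ssE : forall i, semisimple (Ei i))
  (M M' : fdbimod (prodalg Ei) (prodalg Ei))
  (M0 : {vspace M}) (M0' : {vspace M'})
  (freeM : Zfree_generator M0) (freeM' : Zfree_generator M0')
  (D : tensalg M -> TT M) (D' : tensalg M' -> TT M')
  (HD : is_Delta M0 D) (HD' : is_Delta M0' D')
  (L : 'I_n.+1 -> seq (prodalg Ei))
  (HL : forall i, basis_of (<[prod_idem Ei i]> * fullv)%VS (L i))
  (A : 'I_n.+1 -> 'I_n.+1 -> seq M) (A' : 'I_n.+1 -> 'I_n.+1 -> seq M')
  (HA : forall i j, basis_of (peirce M0 i j) (A i j))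
  (HA' : forall i j, basis_of (peirce M0' i j) (A' i j))
  (star : M -> prodalg Ei -> M -> prodalg Ei)
  (star' : M' -> prodalg Ei -> M' -> prodalg Ei)
  (Hstar : is_dual L A star) (Hstar' : is_dual L A' star')
  (phi : {lrmorphism fts M -> fts M'})
  (phi_bij : bijective phi)
  (phi_E : forall s : prodalg Ei, phi (fts_E M s) = fts_E M' s)
  (P : fts M) (HP : potential P) :
  phi @` Rideal D L A star P = Rideal D' L A' star' (phi P).
Proof.
case: phi_bij => psi phiK psiK.
have hphi : ring_map_over_E phi by split; [apply: rmorphD|apply: rmorphM|].
have hpsi : ring_map_over_E psi.
  split=> [f g|f g|s]; apply: (can_inj phiK); rewrite psiK.
  - by rewrite rmorphD /= !psiK.
  - by rewrite rmorphM /= !psiK.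
  - by rewrite phi_E.
apply/seteqP; split=> [_ [f Rf <-]|g Rg].
  have cI := closed_ideal_preim ssE hphi (Rideal_closed D' L A' star' (phi P)).
  apply: (Rideal_sub freeM HD HL HA Hstar cI _ Rf) => c hc /=.
  have := cder_Rideal freeM' HD' HL HA' Hstar' (phi P)
    (cder_transport ssE hpsi hphi psiK hc).
  by rewrite phiK (over_E_1 hpsi).
have cI := closed_ideal_preim ssE hpsi (Rideal_closed D L A star P).
exists (psi g); last exact: psiK.
apply: (Rideal_sub freeM' HD' HL HA' Hstar' cI _ Rg) => c hc /=.
have := cder_Rideal freeM HD HL HA Hstar P (cder_transport ssE hphi hpsi phiK hc).
by rewrite (over_E_1 hphi).
Qed.
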